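(* Let $n\ge2$, $1<p<\infty$, let $\Omega\subset\mathbb{R}^n$ be a bounded John domain, let $s\in(0,1)$, and let $\beta\in\mathbb{R}$ satisfy $$\beta p>-(n-\dim_A(\partial\Omega)).$$ Then there is a constant $C$ such that for every $\tau\in(0,1)$ and every $u\in W^{s,p}(\Omega,d^{\beta p})$, $$\inf_{c\in\mathbb{R}}\|u-c\|_{L^p(\Omega,d^{\beta p})}\le C\,\tau^{s-n}\left(\int_\Omega\int_{\Omega\cap B(x,\tau d(x))}\frac{|u(y)-u(x)|^p}{|y-x|^{n+sp}}\,\delta(x,y)^{(\beta+s)p}\,dy\,dx\right)^{\frac1p},$$ where $\delta(x,y)=\min\{d(x),d(y)\}$. The constant $C$ is independent of $\tau$ and $u$.
   Context: Notation: $d(x)=\mathrm{dist}(x,\partial\Omega)$; $B(x,r)$ is the ball of center $x$ and radius $r$. For a weight $\omega$ (measurable, a.e. positive), $\|f\|_{L^p(\Omega,\omega)}=(\int_\Omega|f|^p\omega\,dx)^{1/p}$. Here $u\in W^{s,p}(\Omega,d^{\beta p})$ is understood as: $u\in L^p(\Omega,d^{\beta p})$ and the double integral on the right-hand side is finite (when it is infinite the inequality is trivial). John domain: a bounded domain $\Omega\subset\mathbb{R}^n$ is a John domain if there are constants $0<a_0\le b_0<\infty$ and a point $x_0\in\Omega$ such that for each $x\in\Omega\setminus\{x_0\}$ there is a rectifiable curve $\gamma_x$ in $\Omega$ from $x$ to $x_0$, parametrized by arc length on $[0,L_x]$, $L_x=\mathrm{length}(\gamma_x)$, $\gamma_x(0)=x$,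 with $L_x\le b_0$ and $\mathrm{dist}(\gamma_x(\tau),\partial\Omega)\ge \frac{a_0}{L_x}\tau$ for all $\tau\in[0,L_x]$. Assouad dimension: for $E\subset\mathbb{R}^n$ and $r>0$, $N_r(E)$ is the least number of open balls of radius $r$ needed to cover $E$; $\dim_A(E)$ is the infimum of all $\lambda\ge0$ for which there is $C>0$ such that $\sup_{x\in E}N_r(B_R(x)\cap E)\le C(R/r)^\lambda$ for all $0<r<R$. *)

(* Defs.v *)
From HB Require Import structures.
From mathcomp Require Import all_boot all_order all_algebra.
From mathcomp Require Import all_classical all_reals all_analysis.
From mathcomp Require Import measurable_realfun.

Set Implicit Arguments.
Unset Strict Implicit.
Unset Printing Implicit Defensive.
Import Order.TTheory GRing.Theory Num.Theory.
Import numFieldNormedType.Exports.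
Local Open Scope classical_set_scope.
Local Open Scope ring_scope.

Definition measure_rV_display : measure_display -> measure_display.
Proof. exact. Qed.

Section measurable_rV.
Context {d : measure_display} {T : sigmaRingType d} (n : nat).

Let coors : 'I_n -> 'rV[T]_n -> T := fun i v => v ord0 i.

Let rV_set0 : g_sigma_preimage coors set0.
Proof. exact: sigma_algebra0. Qed.

Let rV_setC A : g_sigma_preimage coors A -> g_sigma_preimage coors (~` A).
Proof. exact: sigma_algebraC. Qed.

Let rV_bigcup (F : (set 'rV[T]_n)^nat) :
  (forall i, g_sigma_preimage coors (F i)) ->
  g_sigma_preimage coors (\bigcup_i F i).
Proof. exact: sigma_algebra_bigcup. Qed.

HB.instance Definition _ := @isMeasurable.Build (measure_rV_display d)
  'rV[T]_n (g_sigma_preimage coors) rV_set0 rV_setC rV_bigcup.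

End measurable_rV.

Section rV_measurable_fun.
Context {R : realType}.

Lemma measurable_coord n (i : 'I_n) :
  measurable_fun [set: 'rV[R]_n] (fun v => v ord0 i : R).
Proof.
move=> _ Y mY; rewrite setTI; apply: sub_sigma_algebra => /=.
rewrite -bigcup_seq/=; exists i => /=; first by rewrite mem_index_enum.
by exists Y => //; rewrite setTI.
Qed.

Lemma measurable_fun_rVP {d} {X : measurableType d} n (f : X -> 'rV[R]_n) :
  (forall i, measurable_fun [set: X] (fun x => f x ord0 i : R)) ->
  measurable_fun [set: X] f.
Proof.
move=> mf _ A mA; rewrite setTI.
suff : @measurable _ 'rV[R]_n `<=` [set B | measurable (f @^-1` B)] by apply.
apply: smallest_sub.
  split => /= [|B mB|F mF].
  - by rewrite preimage_set0.
  - by rewrite setTD preimage_setC; exact: measurableC.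
  - by rewrite preimage_bigcup; exact: bigcup_measurable.
move=> B; rewrite -bigcup_seq/= => -[i _ [Y mY <-]].
by rewrite setTI /= -comp_preimage -[X in measurable X]setTI; exact: mf.
Qed.

Definition rV_cons n (z : measurableTypeR R * 'rV[R]_n) : 'rV[R]_n.+1 :=
  \row_i oapp (z.2 ord0) z.1 (unlift ord0 i).

Definition rV_uncons n (v : 'rV[R]_n.+1) : measurableTypeR R * 'rV[R]_n :=
  (v ord0 ord0, \row_i v ord0 (lift ord0 i)).

Lemma rV_consK n : cancel (@rV_cons n) (@rV_uncons n).
Proof.
move=> [x v]; rewrite /rV_cons /rV_uncons mxE unlift_none /=; congr pair.
by apply/rowP => i; rewrite !mxE liftK.
Qed.

Lemma measurable_rV_cons n : measurable_fun setT (@rV_cons n).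
Proof.
apply: measurable_fun_rVP => i; have [j ->|->] := unliftP ord0 i.
  apply: (eq_measurable_fun ((fun v : 'rV[R]_n => v ord0 j : R) \o snd)).
    by move=> z _ /=; rewrite mxE liftK.
  exact: (measurableT_comp (measurable_coord j) measurable_snd).
apply: (eq_measurable_fun fst); last exact: measurable_fst.
by move=> z _ /=; rewrite mxE unlift_none.
Qed.

Lemma measurable_rV_uncons n : measurable_fun setT (@rV_uncons n).
Proof.
apply/measurable_fun_pairP; split; first exact: measurable_coord.
apply: measurable_fun_rVP => i.
apply: (eq_measurable_fun (fun v : 'rV[R]_n.+1 => v ord0 (lift ord0 i) : R)).
  by move=> v _ /=; rewrite mxE.
exact: measurable_coord.
Qed.

End rV_measurable_fun.

Section lebesgue_rV.
Context {R : realType}.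
Local Open Scope ereal_scope.

Section step.
Variables (n : nat) (mu : {sigma_finite_measure set 'rV[R]_n -> \bar R}).

Definition lebesgue_rV_step : set 'rV[R]_n.+1 -> \bar R :=
  pushforward (lebesgue_measure \x mu) (@rV_cons R n).

Let lebesgue_rV_step0 : lebesgue_rV_step set0 = 0.
Proof. by rewrite /lebesgue_rV_step /pushforward preimage_set0 measure0. Qed.

Let lebesgue_rV_step_ge0 A : 0 <= lebesgue_rV_step A.
Proof. by rewrite /lebesgue_rV_step /pushforward measure_ge0. Qed.

Let lebesgue_rV_step_sigma_additive : semi_sigma_additive lebesgue_rV_step.
Proof.
move=> F mF tF mUF; rewrite /lebesgue_rV_step /pushforward preimage_bigcup.
have mpre A : measurable A -> measurable (@rV_cons R n @^-1` A).
  by move=> mA; rewrite -[X in measurable X]setTI; exact: measurable_rV_cons.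
apply: measure_semi_sigma_additive.
- by move=> i; exact: mpre.
- apply/trivIsetP => /= i j _ _ ij; rewrite -preimage_setI.
  by move/trivIsetP : tF => /(_ _ _ _ _ ij) ->//; rewrite preimage_set0.
- by rewrite -preimage_bigcup; exact: mpre.
Qed.

HB.instance Definition _ := isMeasure.Build _ _ _ lebesgue_rV_step
  lebesgue_rV_step0 lebesgue_rV_step_ge0 lebesgue_rV_step_sigma_additive.

Let lebesgue_rV_step_sigma_finite : sigma_finite setT lebesgue_rV_step.
Proof.
pose leb : {sigma_finite_measure set (measurableTypeR R) -> \bar R} :=
  @lebesgue_measure R.
have /sigma_finiteP[F [TF ndF Foo]] := sigma_finiteT leb.
have /sigma_finiteP[G [TG ndG Goo]] := sigma_finiteT mu.
exists (fun k => @rV_uncons R n @^-1` (F k `*` G k)).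
  rewrite -preimage_bigcup predeqE => v; split => // _.
  have : setT (rV_uncons v).1 by []. have : setT (rV_uncons v).2 by [].
  rewrite {1}TG {1}TF => -[k _ Gk] [l _ Fl]; exists (maxn k l) => //; split.
    by move: Fl; apply/subsetPset/ndF/leq_maxr.
  by move: Gk; apply/subsetPset/ndG/leq_maxl.
move=> k; have [mF Fk] := Foo k; have [mG Gk] := Goo k; split.
  by rewrite -[X in measurable X]setTI; apply: measurable_rV_uncons => //;
    exact: measurableX.
rewrite /lebesgue_rV_step /pushforward -comp_preimage.
rewrite (_ : _ \o _ = id); last by apply/funext => z; exact: rV_consK.
by rewrite preimage_id product_measure1E// lte_mul_pinfty// ge0_fin_numE.
Qed.

HB.instance Definition _ := Measure_isSigmaFinite.Build _ _ _
  lebesgue_rV_step lebesgue_rV_step_sigma_finite.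

End step.

(* Lebesgue measure on R^n, on the product of the Borel sigma-algebras: the
   point mass for n = 0, then the image of (dimension 1) \x (dimension n) under
   R * R^n -> R^n.+1. *)
Fixpoint lebesgue_rV n : {sigma_finite_measure set 'rV[R]_n -> \bar R} :=
  match n with
  | 0 => \d_(0%R : 'rV[R]_0)
  | n'.+1 => lebesgue_rV_step (lebesgue_rV n')
  end.

Lemma lebesgue_rV_box n (A : 'I_n -> set (measurableTypeR R)) :
  (forall i, measurable (A i)) ->
  lebesgue_rV n [set v | forall i, A i (v ord0 i)] =
  \prod_(i < n) lebesgue_measure (A i).
Proof.
elim: n A => [|n ih] A mA.
  rewrite big_ord0 /= diracE mem_set//; by case.
pose B := [set v : 'rV[R]_n | forall i, A (lift ord0 i) (v ord0 i)].
have mB : measurable B.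
  rewrite (_ : B = \bigcap_(i in [set: 'I_n])
      ((fun v : 'rV[R]_n => v ord0 i) @^-1` A (lift ord0 i))).
    apply: fin_bigcap_measurable => // i _.
    rewrite -[X in measurable X]setTI.
    exact: (measurable_coord _ measurableT (mA _)).
  by apply/seteqP; split => v Bv i; [move=> _; exact: Bv|exact: (Bv i)].
rewrite big_ord_recl -(ih (fun i => A (lift ord0 i)))// -product_measure1E//.
congr (product_measure1 _ _ _); apply/seteqP; split => -[x v] /=.
  move=> Azv; split => [|i].
    by have := Azv ord0; rewrite mxE unlift_none.
  by have := Azv (lift ord0 i); rewrite mxE liftK.
by move=> [/= Ax Av] i; rewrite mxE; have [j ->|->] := unliftP ord0 i => //=.
Qed.

End lebesgue_rV.

Section geometry.
Context {R : realType} {n : nat}.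
Implicit Types (x y : 'rV[R]_n) (E : set 'rV[R]_n).

(* The library norm on 'rV[R]_n is the max norm; this is the Euclidean one. *)
Definition enorm x : R := Num.sqrt (\sum_i x ord0 i ^+ 2).

Definition eball x (r : R) : set 'rV[R]_n := [set y | enorm (y - x) < r].

Definition boundary E : set 'rV[R]_n := closure E `\` E°.

Definition dist_to E x : R := inf [set enorm (x - y) | y in E].

Definition bdist E x : R := dist_to (boundary E) x.

Definition domain E := [/\ open E, connected E & E !=set0].

Definition curve_length (a b : R) (g : R -> 'rV[R]_n) : \bar R :=
  ereal_sup [set (\sum_(i < size s)
      enorm (g (nth b (a :: s) i.+1) - g (nth b (a :: s) i)))%:E
    | s in [set s | itv_partition a b s]].

Definition arc_length_curve (L : R) (g : R -> 'rV[R]_n) :=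
  {within `[0, L], continuous g} /\
  forall t, t \in `[0, L] -> curve_length 0 t g = t%:E.

Definition John_domain E := [/\ domain E, bounded_set E &
  exists a0 b0 x0, [/\ 0 < a0, a0 <= b0, E x0 &
    forall x, E x -> x <> x0 -> exists L g,
      [/\ 0 <= L, L <= b0, arc_length_curve L g, g 0 = x & g L = x0] /\
      forall t, t \in `[0, L] -> E (g t) /\ a0 / L * t <= bdist E (g t)]].

Definition covered_by E (r : R) (k : nat) :=
  exists c : 'I_k -> 'rV[R]_n, E `<=` \bigcup_i eball (c i) r.

(* Valued in \bar R: +oo when no finite cover exists. *)
Definition covering_number E (r : R) : \bar R :=
  ereal_inf [set k%:R%:E | k in covered_by E r].

Definition dimA E : \bar R :=
  ereal_inf [set l%:E | l in [set l : R | 0 <= l /\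
    exists2 C : R, 0 < C & forall r rho : R, 0 < r -> r < rho ->
      (ereal_sup [set covering_number (eball x rho `&` E) r | x in E]
        <= (C * (rho / r) `^ l)%:E)%E]].

End geometry.

Section function_spaces.
Context {R : realType} {n : nat}.
Notation mu := (@lebesgue_rV R n).
Implicit Types (D : set 'rV[R]_n) (u w : 'rV[R]_n -> R).

(* Measurability for the completion of mu. Below, such functions are integrated
   against mu itself: for f >= 0 the integral of f is the supremum of the
   integrals of the Borel simple functions below f, which for a completion-
   measurable f is its integral against the completed measure. *)
Definition lebesgue_measurable_fun D u :=
  forall Y : set R, measurable Y -> completed_algebra_gen mu (D `&` u @^-1` Y).

Definition wLp_norm D w (p : R) u : \bar R :=
  (\int[mu]_(x in D) (`|u x| `^ p * w x)%:E) `^ p^-1.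

Definition dist_weight D (a : R) : 'rV[R]_n -> R := fun x => bdist D x `^ a.

Definition frac_energy D (s p beta tau : R) u : \bar R :=
  \int[mu]_(x in D) \int[mu]_(y in D `&` eball x (tau * bdist D x))
    (`|u y - u x| `^ p / enorm (y - x) `^ (n%:R + s * p) *
     Num.min (bdist D x) (bdist D y) `^ ((beta + s) * p))%:E.

(* The space W^{s,p}(D, d^{beta p}), where finiteness of the Gagliardo energy is
   required for the inner ball B(x, tau d(x)) only; hence the parameter tau. *)
Definition frac_Sobolev D (s p beta tau : R) u :=
  [/\ lebesgue_measurable_fun D u,
      (wLp_norm D (dist_weight D (beta * p)) p u < +oo)%E &
      (frac_energy D s p beta tau u < +oo)%E].

End function_spaces.

(* Main.v *)
Require Import Defs.
From HB Require Import structures.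
From mathcomp Require Import all_boot all_order all_algebra.
From mathcomp Require Import all_classical all_reals all_analysis.
From mathcomp Require Import measurable_realfun ring lra.
Set Implicit Arguments.
Unset Strict Implicit.
Unset Printing Implicit Defensive.
Import Order.TTheory GRing.Theory Num.Theory.
Import numFieldNormedType.Exports.
Local Open Scope classical_set_scope.
Local Open Scope ring_scope.

(* Along a John curve from x to the centre x0, jump from a point q to the last
   point of the curve at distance at most tau d(q) / 8 from q. The cubes of side
   comparable to tau d(q) around the points of the resulting chain are disjoint,
   and the weights d(q)^-e of these points sum to at most a multiple of
   tau^-1 d(x)^-e, for every e > 0. The means of u over two consecutive cubes
   differ by an amount controlled by the energy density G on the first cube, so
   Hoelder's inequality with the weights d(q)^-e bounds |u(x) - c|^p by the sum of
   a multiple of d(x)^(- beta p) G(x) and of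
   d(x)^-eps \int_{|x - y| <= M d(y)} d(y)^(eps - n - beta p) G(y) dy,
   with eps = e (p - 1). After multiplication by d(x)^(beta p) and exchange of the
   integrals, it remains to bound the integral of d(x)^(beta p - eps) over
   |x - y| <= M d(y) by a multiple of d(y)^(n + beta p - eps). This follows by
   summing over dyadic layers of d, each of which is covered by balls centred
   near the boundary whose number is bounded through the Assouad dimension;
   eps is chosen with beta p - eps > dim_A - n. The powers of tau that appear
   are at most tau^((s - n) p) because (n - 1) (p - 1) >= 0. *)

(** * Euclidean norm, distance functions and curves *)

Section euclidean_norm.
Context {R : realType} {n : nat}.
Implicit Types x y z : 'rV[R]_n.

Lemma enorm_ge0 x : 0 <= enorm x.
Proof. exact: sqrtr_ge0. Qed.

Lemma sqr_enorm x : enorm x ^+ 2 = \sum_i x ord0 i ^+ 2.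
Proof. by rewrite sqr_sqrtr// sumr_ge0// => i _; exact: sqr_ge0. Qed.

Lemma ler_coord_enorm x i : `|x ord0 i| <= enorm x.
Proof.
rewrite -(@ler_pXn2r _ 2)// ?nnegrE ?enorm_ge0// sqr_enorm real_normK ?num_real//.
by rewrite (bigD1 i)//= lerDl sumr_ge0// => j _; exact: sqr_ge0.
Qed.

Lemma enorm_eq0 x : enorm x = 0 -> x = 0.
Proof.
move=> x0; apply/rowP => i; rewrite mxE; apply/eqP; rewrite -normr_le0 -x0.
exact: ler_coord_enorm.
Qed.

Lemma enorm0 : enorm (0 : 'rV[R]_n) = 0.
Proof. by rewrite /enorm big1 ?sqrtr0// => i _; rewrite mxE expr0n. Qed.

Lemma enormN x : enorm (- x) = enorm x.
Proof. by congr Num.sqrt; apply: eq_bigr => i _; rewrite mxE sqrrN. Qed.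

Lemma enormC x y : enorm (x - y) = enorm (y - x).
Proof. by rewrite -enormN opprB. Qed.

Lemma cauchy_schwarz x y : \sum_i x ord0 i * y ord0 i <= enorm x * enorm y.
Proof.
have [/enorm_eq0 ->|x0] := eqVneq (enorm x) 0.
  by rewrite enorm0 mul0r big1// => i _; rewrite mxE mul0r.
have [/enorm_eq0 ->|y0] := eqVneq (enorm y) 0.
  by rewrite enorm0 mulr0 big1// => i _; rewrite mxE mulr0.
have xy0 : 0 < enorm x * enorm y.
  by rewrite mulr_gt0// lt_neqAle eq_sym ?x0 ?y0 enorm_ge0.
have : 0 <= \sum_i (enorm y * x ord0 i - enorm x * y ord0 i) ^+ 2.
  by apply: sumr_ge0 => i _; exact: sqr_ge0.
rewrite (_ : \sum_i _ = (enorm y ^+ 2) * \sum_i x ord0 i ^+ 2 +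
    (enorm x ^+ 2) * \sum_i y ord0 i ^+ 2
    - (2 * (enorm x * enorm y)) * \sum_i x ord0 i * y ord0 i); last first.
  by rewrite !mulr_sumr -big_split -sumrB; apply: eq_bigr => i _ /=; ring.
rewrite -!sqr_enorm => h.
suff : 0 <= (enorm x * enorm y) * (enorm x * enorm y - \sum_i x ord0 i * y ord0 i).
  by rewrite pmulr_rge0// subr_ge0.
by move: h; set S := \sum_i _; lra.
Qed.

Lemma ler_enormD x y : enorm (x + y) <= enorm x + enorm y.
Proof.
rewrite -(@ler_pXn2r _ 2)// ?nnegrE ?addr_ge0 ?enorm_ge0//.
rewrite sqrrD !sqr_enorm.
rewrite (_ : \sum_i _ = \sum_i x ord0 i ^+ 2 + 2 * (\sum_i x ord0 i * y ord0 i)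
   + \sum_i y ord0 i ^+ 2).
  by have := cauchy_schwarz x y; lra.
by rewrite mulr_sumr -!big_split; apply: eq_bigr => i _ /=; rewrite mxE; ring.
Qed.

Lemma ler_enorm_dist x y z : enorm (x - z) <= enorm (x - y) + enorm (y - z).
Proof. by rewrite (_ : x - z = (x - y) + (y - z)) ?ler_enormD// addrA subrK. Qed.

Lemma enormZ (a : R) x : enorm (a *: x) = `|a| * enorm x.
Proof.
rewrite /enorm (_ : \sum_i _ = a ^+ 2 * \sum_i x ord0 i ^+ 2).
  by rewrite sqrtrM ?sqr_ge0// sqrtr_sqr.
by rewrite mulr_sumr; apply: eq_bigr => i _; rewrite mxE; ring.
Qed.

Lemma enorm_le_coord x (r : R) :
  (forall i, `|x ord0 i| <= r) -> enorm x <= n%:R * r.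
Proof.
move=> xr; have [n0|n0] := posnP n.
  suff -> : enorm x = 0 by rewrite n0 mul0r.
  by rewrite /enorm big1 ?sqrtr0// => i _; have := ltn_ord i; rewrite {2}n0.
have r0 : 0 <= r by exact: le_trans (xr (Ordinal n0)).
have nr0 : 0 <= n%:R * r by rewrite mulr_ge0.
rewrite -(@ler_pXn2r _ 2)// ?nnegrE ?enorm_ge0// sqr_enorm.
apply: (@le_trans _ _ (\sum_(i < n) r ^+ 2)).
  apply: ler_sum => i _; rewrite -[leLHS]real_normK ?num_real//.
  by rewrite lerXn2r ?nnegrE.
rewrite sumr_const card_ord exprMn -[_ *+ n]mulr_natl ler_wpM2r ?sqr_ge0//.
by rewrite -natrX ler_nat leq_pmulr.
Qed.

End euclidean_norm.

Section distance.
Context {R : realType} {n : nat}.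
Implicit Types (x y z : 'rV[R]_n) (E : set 'rV[R]_n).

Lemma has_lbound_dist E x : has_lbound [set enorm (x - y) | y in E].
Proof. by exists 0 => _ [y _ <-]; exact: enorm_ge0. Qed.

Lemma dist_to_le E x y : E y -> dist_to E x <= enorm (x - y).
Proof. by move=> Ey; apply: ge_inf; [exact: has_lbound_dist|exists y]. Qed.

Lemma dist_to_approx E x (e : R) : E !=set0 -> dist_to E x < e ->
  exists2 y, E y & enorm (x - y) < e.
Proof.
move=> [z Ez] /inf_lt[]; first by exists (enorm (x - z)); exists z.
by move=> _ [y Ey <-] ?; exists y.
Qed.

Lemma dist_to_ge0 E x : 0 <= dist_to E x.
Proof.
have [->|/set0P E0] := eqVneq E set0; first by rewrite /dist_to image_set0 inf0.
rewrite leNgt; apply/negP => /(dist_to_approx E0)[y _].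
by rewrite ltNge enorm_ge0.
Qed.

Lemma dist_to_lip E x y : E !=set0 -> dist_to E x <= dist_to E y + enorm (x - y).
Proof.
move=> E0; rewrite leNgt -ltrBrDr; apply/negP => /(dist_to_approx E0)[z Ez].
have := dist_to_le x Ez; have := ler_enorm_dist x y z; lra.
Qed.

End distance.

Section arc_length.
Context {R : realType} {n : nat}.

(** Adding [b] to a partition of [0, a] lengthens the inscribed polygon by the chord from [g a] to
    [g b]. Since the lengths up to [a] and [b] are [a] and [b], the chord is at most [b - a]. *)
Lemma arc_length_lip (L : R) (g : R -> 'rV[R]_n) (a b : R) :
  arc_length_curve L g -> 0 <= a -> a <= b -> b <= L ->
  enorm (g b - g a) <= b - a.
Proof.
move=> [_ gL] a0; rewrite le_eqVlt => /predU1P[->|ab] bL.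
  by rewrite !subrr enorm0.
have b0 : 0 < b by exact: le_lt_trans ab.
have lb : curve_length 0 b g = b%:E by apply: gL; rewrite in_itv/= (ltW b0).
have la : curve_length 0 a g = a%:E.
  by apply: gL; rewrite in_itv/= a0 (le_trans (ltW ab)).
have ub s : itv_partition 0 b s ->
    \sum_(i < size s) enorm (g (nth b (0 :: s) i.+1) - g (nth b (0 :: s) i)) <= b.
  by move=> sb; rewrite -lee_fin -lb; apply: ereal_sup_ubound => /=; exists s.
move: a0; rewrite le_eqVlt => /predU1P[a0|a0].
  by have := ub [:: b] (itv_partition1 b0); rewrite big_ord1/= -a0 subr0.
suff : (curve_length 0 a g <= (b - enorm (g b - g a))%:E)%E.
  by rewrite la lee_fin; lra.
apply: ge_ereal_sup => _ [s /= sa <-]; rewrite lee_fin lerBrDr.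
have sb : itv_partition 0 b (rcons s b).
  by rewrite -cats1; apply: itv_partition_cat sa _; exact: itv_partition1.
have := ub _ sb; rewrite size_rcons big_ord_recr/=.
apply: le_trans; rewrite le_eqVlt; apply/orP; left; apply/eqP; congr (_ + _).
  apply: eq_bigr => i _ /=.
  rewrite nth_rcons ltn_ord (set_nth_default b)//.
  case: i => -[//|i] /= si.
  by rewrite nth_rcons (ltnW si) (set_nth_default b a)// ltnW.
congr (enorm (g _ - g _)).
  by rewrite nth_rcons ltnn eqxx.
(* The last point of a partition of [0, a] is [a], so the added chord starts at [g a]. *)
case: sa => _ /eqP sa.
rewrite -rcons_cons nth_rcons/= ltnS leqnn (set_nth_default 0)// -{1}sa.
exact/esym/(nth_last 0 (0 :: s)).
Qed.

End arc_length.

Section euclidean_topology.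
Context {R : realType} {n : nat}.
Implicit Types (x y z : 'rV[R]_n) (E : set 'rV[R]_n).

(** The ambient topology is that of the maximum norm, which is comparable to [enorm] up to the
    factor [n]; dividing by [n.+1] keeps the inequality strict and covers [n = 0]. *)
Lemma nbhs_eballP x E : nbhs x E <-> exists2 e : R, 0 < e & eball x e `<=` E.
Proof.
split.
  move=> /nbhs_ballP[e/= e0 xE]; exists e => // y xy; apply: xE; split=> // i j.
  rewrite [i]ord1 -ball_normE/= distrC (le_lt_trans _ xy)//.
  by have := ler_coord_enorm (y - x) j; rewrite !mxE.
move=> [e e0 xE]; apply/nbhs_ballP; exists (e / n.+1%:R) => /=.
  by rewrite divr_gt0.
move=> y xy; apply: xE => /=.
have : enorm (y - x) <= n%:R * (e / n.+1%:R).
  apply: enorm_le_coord => i; have := xy.2 ord0 i.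
  by rewrite -ball_normE/= distrC !mxE => /ltW.
move=> /le_lt_trans; apply.
by rewrite mulrCA gtr_pMr// ltr_pdivrMr// mul1r ltr_nat.
Qed.

Lemma open_eballP E : open E <->
  forall x, E x -> exists2 e : R, 0 < e & eball x e `<=` E.
Proof.
by rewrite openE; split => oE x Ex; [exact/nbhs_eballP/oE|exact/nbhs_eballP/oE].
Qed.

Lemma open_bdist_gt0 E x : open E -> boundary E !=set0 -> E x -> 0 < bdist E x.
Proof.
move=> oE E0 Ex; have [e e0 xE] := (open_eballP E).1 oE x Ex.
apply: (lt_le_trans e0); rewrite leNgt; apply/negP => /(dist_to_approx E0)[y].
rewrite enormC => -[_ yE] /xE Ey; apply: yE.
by rewrite (_ : E° = E)//; exact/interior_id.
Qed.

(* The last point of the segment [x, y] in the closure of E would be a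
   boundary point of E at distance less than bdist E x from x. *)
Lemma eball_bdist_sub E x : open E -> E x -> eball x (bdist E x) `<=` E.
Proof.
move=> oE Ex y /= yx; apply: contrapT => nEy.
pose f (t : R) := x + t *: (y - x).
have fB (s t : R) : enorm (f s - f t) = `|s - t| * enorm (y - x).
  by rewrite -enormZ; congr enorm; rewrite /f scalerBl opprD addrACA subrr add0r.
pose S := [set t : R | 0 <= t <= 1 /\ E (f t)].
have S0 : S 0 by split; rewrite ?lexx ?ler01// /f scale0r addr0.
have Sle : ubound S 1 by move=> t [/andP[]].
have hS : has_sup S by split; [exists 0|exists 1].
have s0 : 0 <= sup S by apply: ub_le_sup => //; exists 1.
have s1 : sup S <= 1 by apply: ge_sup => //; exists 0.
have D0 : 0 <= enorm (y - x) by exact: enorm_ge0.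
suff bs : boundary E (f (sup S)).
  have := dist_to_le x bs; rewrite leNgt => /negP; apply.
  apply: le_lt_trans yx; have f0 : f 0 = x by rewrite /f scale0r addr0.
  have -> : enorm (x - f (sup S)) = enorm (f 0 - f (sup S)) by rewrite f0.
  by rewrite fB sub0r normrN ger0_norm// ler_piMl.
have D1 : 0 < enorm (y - x) + 1 by rewrite ltr_wpDl.
split.
  move=> B /nbhs_eballP[e e0 eB].
  have [t [t01 Et] tS] := sup_adherent (divr_gt0 e0 D1) hS.
  exists (f t); split => //; apply: eB; change (enorm (f t - f (sup S)) < e); rewrite fB.
  have tle : t <= sup S by apply: ub_le_sup; [exists 1|split].
  rewrite distrC ger0_norm ?subr_ge0//.
  have : (sup S - t) * (enorm (y - x) + 1) < e by rewrite -ltr_pdivlMr//; lra.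
  have : 0 <= sup S - t by rewrite subr_ge0.
  rewrite mulrDr mulr1; lra.
(* If [f (sup S)] were interior to [E], then [sup S < 1] because [f 1 = y] is outside [E], and the
   segment would stay in [E] a little beyond [sup S]. *)
move=> /nbhs_eballP[e e0 eB].
have ES : E (f (sup S)) by apply: eB; rewrite /eball/= subrr enorm0.
have s1' : sup S < 1.
  rewrite lt_neqAle s1 andbT; apply: contra_notN nEy => /eqP S1.
  by move: ES; rewrite S1 /f scale1r addrC subrK.
pose d := Num.min (1 - sup S) (e / (enorm (y - x) + 1)).
have d0 : 0 < d by rewrite lt_min subr_gt0 s1' divr_gt0.
have : S (sup S + d).
  split; first by rewrite addr_ge0 ?(ltW d0)//= -lerBrDl ge_min lexx.
  apply: eB; change (enorm (f (sup S + d) - f (sup S)) < e).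
  rewrite fB addrAC subrr add0r gtr0_norm//.
  have : d * (enorm (y - x) + 1) <= e by rewrite -ler_pdivlMr// ge_min lexx orbT.
  rewrite mulrDr mulr1; lra.
move=> /(ub_le_sup (ex_intro _ 1 Sle)); lra.
Qed.
End euclidean_topology.

(** * Inequalities for real powers *)

Section power_estimates.
Context {R : realType}.
Implicit Types a b e : R.

Lemma ler_powRN a b e : 0 < a -> a <= b -> 0 <= e -> b `^ (- e) <= a `^ (- e).
Proof.
move=> a0 ab e0; have b0 := lt_le_trans a0 ab.
by rewrite !powRN lef_pV2 ?posrE ?powR_gt0// ge0_ler_powR ?nnegrE// ltW.
Qed.

(** Follows from exp t >= 1 + t and ln (1 + v) >= v / (1 + v) >= v / 2, the last because v <= 1. *)
Lemma powR1D_ge (v e : R) : 0 <= v -> v <= 1 -> 0 <= e ->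
  1 + e * v / 2 <= (1 + v) `^ e.
Proof.
move=> v0 v1 e0; have v10 : 0 < 1 + v by rewrite ltr_pwDl.
rewrite /powR gt_eqF//; apply: le_trans (expR_ge1Dx _).
rewrite lerD2l -mulrA ler_wpM2l//.
rewrite -[1 + v]invrK lnV ?posrE ?invr_gt0//.
have -> : (1 + v)^-1 = 1 + (- (v / (1 + v))) by field; rewrite gt_eqF.
have vv : v / 2 <= v / (1 + v).
  by rewrite ler_wpM2l// lef_pV2 ?posrE//; lra.
apply: le_trans vv _; rewrite lerNr; apply: le_ln1Dx.
by rewrite ltrN2 ltr_pdivrMr// mul1r; lra.
Qed.

(** The step from [m] to [m'] is at least [v * m] with [v = t * c / 8], so [m^-e] drops by a
    proportion of order [t]; this pays for [D^-e] at the price of a factor [1 / t]. Along a chain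
    the differences telescope. *)
Lemma powRN_telescope (e c : R) : 0 < e -> 0 < c -> c <= 1 ->
  exists2 K : R, 0 < K & forall t m m' D : R, 0 < t -> t < 1 -> 0 < m ->
    c * m <= D -> m + t * D / 8 <= m' ->
    D `^ (- e) + K / t * m' `^ (- e) <= K / t * m `^ (- e).
Proof.
move=> e0 c0 c1.
have e1 : 0 < 1 + e by rewrite ltr_pwDl// ltW.
(* Chosen so that [K / t * (e * v / 2)] equals [(1 + e) * c^-e]; the factor [1 + e] absorbs the
   denominator [1 + e * v / 2]. *)
exists (c `^ (- e) * (1 + e) * 16 / (e * c)).
  by rewrite divr_gt0 ?mulr_gt0 ?powR_gt0.
move=> t m m' D t0 t1 m0 mD mm'.
set K := _ / (e * c); have [v vE] : exists v, v = t * c / 8 by eexists.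
have tc0 : 0 < t * c by rewrite mulr_gt0.
have tc1 : t * c <= 1 by rewrite mulr_ile1// ltW.
have v0 : 0 < v by rewrite vE divr_gt0.
have v1 : v <= 1 by rewrite vE; lra.
have ev0 : 0 < e * v by rewrite mulr_gt0.
have ev1 : e * v <= e by rewrite ler_piMr// ltW.
have DM : D `^ (- e) <= c `^ (- e) * m `^ (- e).
  rewrite -powRM ?(ltW c0) ?(ltW m0)//; apply: ler_powRN mD (ltW e0).
  by rewrite mulr_gt0.
have m'M : m' `^ (- e) <= m `^ (- e) * (1 + e * v / 2)^-1.
  apply: (@le_trans _ _ ((m * (1 + v)) `^ (- e))).
    apply: ler_powRN (ltW e0); first by rewrite mulr_gt0// ltr_pwDl// ltW.
    apply: le_trans mm'; rewrite mulrDr mulr1 lerD2l vE.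
    have : t * (c * m) <= t * D by rewrite ler_wpM2l// ltW.
    have -> : m * (t * c / 8) = t * (c * m) / 8 by ring.
    by lra.
  have v10 : 0 < 1 + v by rewrite addr_gt0.
  rewrite powRM ?(ltW m0) ?(ltW v10)// ler_wpM2l ?powR_ge0// powRN.
  by rewrite lef_pV2 ?posrE ?powR_gt0 ?addr_gt0 ?divr_gt0// powR1D_ge// ltW.
apply: (le_trans (lerD DM (ler_wpM2l _ m'M))).
  by rewrite ltW// !divr_gt0 ?mulr_gt0 ?powR_gt0.
set I := (1 + e * v / 2)^-1.
suff h : c `^ (- e) <= K / t * (1 - I).
  have := ler_wpM2l (powR_ge0 m (- e)) h.
  by move: (K / t) (c `^ _) (m `^ _) I {h} => k1 k2 k3 k4; lra.
have -> : 1 - I = (e * v / 2) / (1 + e * v / 2).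
  by rewrite /I; field; rewrite gt_eqF// addrC ltr_wpDl// ltW.
have -> : K / t * (e * v / 2 / (1 + e * v / 2)) =
    c `^ (- e) * ((1 + e) / (1 + e * v / 2)).
  rewrite /K vE; field; rewrite (gt_eqF t0) (gt_eqF e0) (gt_eqF c0) !andbT/= gt_eqF//.
  by move: ev0; rewrite vE; lra.
by rewrite ler_peMr ?powR_ge0// ler_pdivlMr ?mul1r; lra.
Qed.

End power_estimates.

(** * Chains of last exit points *)

Section John_chain.
Context {R : realType} {n : nat}.

Definition lipschitz1_on (L : R) (g : R -> 'rV[R]_n) := forall a b : R,
  0 <= a -> a <= b -> b <= L -> enorm (g b - g a) <= b - a.

(** Take for [t1] the supremum of the times at which the curve is within [r] of [g t]. If [t1 < L],
    the curve stays at distance at least [r] from then on, and speed at most one gives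
    [t + r <= t1]. *)
Lemma last_exit (L t r : R) (g : R -> 'rV[R]_n) : lipschitz1_on L g ->
  0 <= t -> t <= L -> 0 < r ->
  exists t1, [/\ t <= t1, t1 <= L, enorm (g t1 - g t) <= r & t1 = L \/
    (t + r <= t1 /\ forall t', t1 <= t' -> t' <= L -> r <= enorm (g t' - g t))].
Proof.
move=> lip t0 tL r0.
pose S := [set t' : R | [/\ t <= t', t' <= L & enorm (g t' - g t) <= r]].
have St : S t by split => //; rewrite subrr enorm0 ltW.
have SL : ubound S L by move=> t' [].
have uS : has_ubound S by exists L.
have hS : has_sup S by split => //; exists t.
have supL : sup S <= L by apply: ge_sup => //; exists t.
have tsup : t <= sup S by exact: ub_le_sup.
have supr : enorm (g (sup S) - g t) <= r.
  apply/ler_addgt0Pr => e e0; have [t' St' t'e] := sup_adherent e0 hS.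
  have t's : t' <= sup S by exact: ub_le_sup.
  case: St' => tt' _ t'r; apply: le_trans (ler_enorm_dist _ (g t') _) _.
  by have := lip t' (sup S) (le_trans t0 tt') t's supL; lra.
exists (sup S); split => //; have [LS|SltL] := leP L (sup S).
  by left; apply/eqP; rewrite eq_le LS supL.
right; split.
  rewrite leNgt; apply/negP => rS.
  have /(ub_le_sup uS) : S (Num.min L (t + r)).
    split; first by rewrite le_min tL lerDl ltW.
      by rewrite ge_min lexx.
    apply: le_trans (lip _ _ t0 _ _) _; rewrite ?ge_min ?lexx//.
      by rewrite le_min tL lerDl ltW.
    by rewrite lerBlDl ge_min lexx orbT.
  by rewrite ge_min !leNgt SltL rS.
have far t' : sup S < t' -> t' <= L -> r < enorm (g t' - g t).
  move=> St' t'L; rewrite ltNge; apply/negP => t'r.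
  suff /(ub_le_sup uS) : S t' by rewrite leNgt St'.
  by split => //; rewrite (le_trans tsup)// ltW.
move=> t'; rewrite le_eqVlt => /predU1P[<- _|St' t'L]; last exact/ltW/far.
(* At the supremum itself the inequality is the limit of [far] at times decreasing to [sup S]. *)
apply/ler_addgt0Pr => e e0.
pose t2 := Num.min L (sup S + e).
have St2 : sup S < t2 by rewrite lt_min SltL ltrDl.
have t2L : t2 <= L by rewrite ge_min lexx.
have t2e : t2 <= sup S + e by rewrite ge_min lexx orbT.
have := far _ St2 t2L.
have := lip (sup S) t2 (le_trans t0 tsup) (ltW St2) t2L.
by have := ler_enorm_dist (g t2) (g (sup S)) (g t); lra.
Qed.

Variables (Omega : set 'rV[R]_n).
Local Notation d := (bdist Omega).

(** [chain_link] is meant for consecutive points and [chain_sep] for a point and every later one: a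
    last exit point lies at distance exactly [tau * d p / 8], and the curve never comes closer
    again. The endpoint that closes a chain is only linked. *)
Definition chain_link (tau : R) (p q : 'rV[R]_n) : bool :=
  enorm (q - p) <= tau * d p / 8.

Definition chain_sep (tau : R) (p q : 'rV[R]_n) : bool :=
  tau * d p / 8 <= enorm (q - p).

(* The points of the chain are successive last exit times; the weights
   (d q)^-e of its points telescope against (d x + t)^-e. *)
Lemma John_curve_chain (e k : R) : 0 < e -> 0 < k -> k <= 1 ->
  boundary Omega !=set0 ->
  exists2 K : R, 0 < K & forall (tau L : R) g, 0 < tau -> tau < 1 ->
    0 <= L -> lipschitz1_on L g -> 0 < d (g 0) ->
    (forall t, 0 <= t -> t <= L -> k * t <= d (g t)) ->
    exists s, [/\ path (chain_link tau) (g 0) s,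
      chain_link tau (last (g 0) s) (g L), pairwise (chain_sep tau) (g 0 :: s),
      {in g 0 :: s, forall q, exists2 t, 0 <= t <= L & q = g t}
      & \sum_(q <- g 0 :: s) d q `^ (- e) <= K / tau * d (g 0) `^ (- e)].
Proof.
move=> e0 k0 k1 bne.
have k30 : 0 < k / 3 by rewrite divr_gt0.
have k31 : k / 3 <= 1 by lra.
have [K K0 tel] := powRN_telescope e0 k30 k31; exists K => //.
move=> tau L g tau0 tau1 L0 lip dx0 kd.
set dx := d (g 0) in dx0 *.
have dlip t : 0 <= t -> t <= L -> dx - t <= d (g t).
  move=> t0 tL; have := lip 0 t (lexx 0) t0 tL; rewrite enormC subr0.
  by have := dist_to_lip (g 0) (g t) bne; rewrite -!/(bdist _ _) -/dx; lra.
(* The Lipschitz bound [dx - t] suffices as long as [2 * t <= dx], the John bound [k * t]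
   afterwards; [k / 3] serves both cases. *)
have dge t : 0 <= t -> t <= L -> k / 3 * (dx + t) <= d (g t).
  move=> t0 tL; have := dlip t t0 tL; have := kd t t0 tL.
  have [tdx|tdx] := leP (2 * t) dx.
    have : k * (dx + t) <= 1 * (dx + t) by rewrite ler_wpM2r// addr_ge0// ltW.
    by lra.
  have : k * (dx + t) <= k * (3 * t) by rewrite ler_wpM2l ?(ltW k0)//; lra.
  by lra.
have dpos t : 0 <= t -> t <= L -> 0 < d (g t).
  by move=> t0 tL; apply: lt_le_trans (dge _ t0 tL); rewrite mulr_gt0// ltr_wpDr.
(* A lower bound for the time gained by each jump, so that the induction on the number of steps
   reaches [L]. *)
pose delta := tau * (k / 3 * dx) / 8.
have delta0 : 0 < delta by rewrite divr_gt0// !mulr_gt0.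
suff main N t : 0 <= t -> t <= L -> L - t <= N%:R * delta ->
    exists s, [/\ path (chain_link tau) (g t) s,
      chain_link tau (last (g t) s) (g L), pairwise (chain_sep tau) (g t :: s),
      {in g t :: s, forall q, exists2 t', t <= t' <= L & q = g t'}
      & \sum_(q <- g t :: s) d q `^ (- e) <= K / tau * (dx + t) `^ (- e)].
  have := main (Num.truncn (L / delta)).+1 0 (lexx 0) L0.
  rewrite subr0 addr0; apply; rewrite -ler_pdivrMr//.
  exact/ltW/truncnS_gt.
elim: N t => [|N IH] t t0 tL.
  rewrite mul0r subr_le0 => Lt; have {Lt}tE : t = L by apply/eqP; rewrite eq_le tL.
  exists [::]; split => //=.
  - rewrite /chain_link tE subrr enorm0 divr_ge0// mulr_ge0 ?(ltW tau0)//.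
    exact: dist_to_ge0.
  - by move=> q; rewrite inE => /eqP ->; exists t; rewrite ?lexx.
  (* The last point has no successor: the telescoping bound is used with the smallest admissible
     [m'], and the term in [m'] is dropped. *)
  - rewrite big_seq1.
    apply: le_trans
      (tel tau (dx + t) _ (d (g t)) _ _ _ (dge _ t0 tL) (lexx _)) => //.
      by rewrite lerDl mulr_ge0 ?powR_ge0// divr_ge0// ltW.
    by rewrite ltr_wpDr.
move=> LN; have r0 : 0 < tau * d (g t) / 8 by rewrite divr_gt0// mulr_gt0// dpos.
have [t1 [tt1 t1L gt1 exit]] := last_exit lip t0 tL r0.
have mt0 : 0 < dx + t by rewrite ltr_wpDr.
case: exit => [t1E|[rt1 far]].
  exists [::]; split => //=.
  - by rewrite /chain_link -t1E.
  - by move=> q; rewrite inE => /eqP ->; exists t; rewrite ?lexx.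
  - rewrite big_seq1.
    apply: le_trans
      (tel tau (dx + t) _ (d (g t)) _ _ _ (dge _ t0 tL) (lexx _)) => //.
    by rewrite lerDl mulr_ge0 ?powR_ge0// divr_ge0// ltW.
have t10 : 0 <= t1 by exact: le_trans tt1.
have [] := IH t1 t10 t1L.
  apply: (@le_trans _ _ (L - t - delta)); last first.
    by move: LN; rewrite -natr1 mulrDl mul1r; lra.
  suff : delta <= tau * d (g t) / 8 by lra.
  rewrite /delta ler_wpM2r// ler_wpM2l ?(ltW tau0)//.
  by apply: le_trans (dge _ t0 tL); rewrite ler_wpM2l ?(ltW k30)// lerDl.
move=> s [ps ls pw sin sums]; exists (g t1 :: s); split => //.
- by rewrite /= {1}/chain_link gt1.
- rewrite pairwise_cons pw andbT; apply/allP => q /sin[t' /andP[t1t' t'L] ->].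
  exact: far.
- move=> q; rewrite inE => /predU1P[->|/sin[t' /andP[t1t' t'L] ->]].
    by exists t; rewrite ?lexx.
  by exists t'; rewrite ?t'L ?(le_trans tt1).
- rewrite big_cons.
  apply: le_trans (tel tau (dx + t) (dx + t1) (d (g t)) _ _ _ _ _) => //.
  + by rewrite lerD2l.
  + exact: dge.
  + by rewrite -addrA lerD2l.
Qed.

End John_chain.

(** * Integrals and means *)

Section nonmeasurable_integrands.
Import HBNNSimple.
Local Open Scope ereal_scope.
Context d (T : measurableType d) (R : realType).
Variable mu : {measure set T -> \bar R}.
Implicit Types (f g : T -> \bar R) (D E N : set T).

(** The integral of a nonnegative function is a supremum over the simple functions below it, and
    enlarging the function or the set only adds such simple functions. *)
Lemma ge0_le_integral_subset D E f g : (forall x, D x -> 0 <= f x) ->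
  (forall x, E x -> 0 <= g x) -> (forall x, D x -> E x /\ f x <= g x) ->
  \int[mu]_(x in D) f x <= \int[mu]_(x in E) g x.
Proof.
move=> f0 g0 fg; rewrite !ge0_integralE//.
apply: le_ereal_sup => _ [h hf <-]; exists h => // x.
apply: le_trans (hf x) _; rewrite !patchE.
case: ifPn => [/set_mem /fg[/mem_set -> //]|_].
by case: ifPn => // /set_mem; exact: g0.
Qed.

(** A simple function below [f] keeps its integral when it is set to 0 on [N], and it then lies
    below [f] restricted to the complement of [N]. This serves for integrands that are measurable
    for the completion only. *)
Lemma ge0_le_integral_setD_null D N f : measurable N -> mu N = 0 ->
  (forall x, D x -> 0 <= f x) ->
  \int[mu]_(x in D) f x <= \int[mu]_(x in D `\` N) f x.
Proof.
move=> mN N0 f0; rewrite [leLHS]ge0_integralE//.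
apply: ge_ereal_sup => _ [h /= hf <-]; rewrite -integralT_nnsfun.
rewrite (ge0_negligible_integral mN measurableT _ _ N0)//; last 2 first.
  by apply/measurable_EFinP; exact: measurable_funPT.
  by move=> x _; rewrite lee_fin.
rewrite [leLHS]integral_mkcond [leRHS]integral_mkcond.
apply: ge0_le_integral_subset => //.
- by move=> x _; rewrite patchE; case: ifPn => // _; rewrite lee_fin.
- by move=> x _; rewrite patchE; case: ifPn => // /set_mem[+ _]; exact: f0.
- move=> x _; split=> //; rewrite !patchE; have := hf x; rewrite patchE.
  case: ifPn => [/set_mem Dx|/negP nDx] hx.
    have [xN|xN] := boolP (x \in N).
      by rewrite !ifF//; apply/negP => /set_mem[_]; apply; exact: set_mem.
    by rewrite !ifT//; apply/mem_set; split=> //; move/mem_set; exact/negP.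
  rewrite [X in _ <= if X then _ else _](_ : _ = false); last first.
    by apply/negP => /set_mem[Dx _]; apply: nDx; exact/mem_set.
  by case: ifPn.
Qed.

End nonmeasurable_integrands.

Section jensen.
Context {R : realType}.
Variable p : R.
Hypothesis p1 : 1 < p.

(* Young's inequality in the form of a tangent line bound for t `^ p *)
Lemma powR_tangent (t m : R) : 0 <= t -> 0 <= m ->
  m `^ p + p * (m `^ (p - 1) * (t - m)) <= t `^ p.
Proof.
move=> t0 m0; have p0 : 0 < p by exact: lt_trans p1.
have p10 : 0 < p - 1 by rewrite subr_gt0.
have q0 : 0 < p / (p - 1) by rewrite divr_gt0.
have pq : p^-1 + (p / (p - 1))^-1 = 1 by field; rewrite !gt_eqF.
have := conjugate_powR t0 (powR_ge0 m (p - 1)) p0 q0 pq.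
rewrite -powRrM.
have -> : (p - 1) * (p / (p - 1)) = p by field; rewrite gt_eqF.
have mp := mulr_powRB1 m0 p0.
set A := m `^ (p - 1) in mp *; set B := m `^ p in mp *; set C := t `^ p.
have -> : C / p + B / (p / (p - 1)) = (C + (p - 1) * B) / p.
  by field; rewrite !gt_eqF.
rewrite ler_pdivlMr// => h.
have -> : B + p * (A * (t - m)) = t * A * p + B - p * (m * A) by ring.
by rewrite mp; lra.
Qed.

(** Hölder's inequality with weights, proved as Jensen's: the tangent bounds at the weighted mean
    [m] of the ratios [a i / th i] are summed with weights [th i], and the linear terms cancel. *)
Lemma weighted_power_mean (I : eqType) (r : seq I) (th a : I -> R) :
  {in r, forall i, 0 < th i} -> (forall i, 0 <= a i) ->
  (\sum_(i <- r) a i) `^ p <= (\sum_(i <- r) th i) `^ (p - 1) *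
    \sum_(i <- r) th i `^ (1 - p) * a i `^ p.
Proof.
move=> th0 a0; have p0 : 0 < p by exact: lt_trans p1.
have [->|rN0] := eqVneq r [::]; first by rewrite !big_nil mulr0 powR0// gt_eqF.
set S := \sum_(i <- r) a i; set Th := \sum_(i <- r) th i.
have Th0 : 0 < Th.
  rewrite /Th; case: r th0 rN0 @S @Th => // i0 r th0 _ _ _.
  rewrite big_cons ltr_pwDl ?th0 ?mem_head// big_seq sumr_ge0// => i ir.
  by rewrite ltW// th0// inE ir orbT.
have S0 : 0 <= S by apply: sumr_ge0.
pose m := S / Th.
have m0 : 0 <= m by rewrite divr_ge0// ltW.
have SE : S = m * Th by rewrite /m mulfVK// gt_eqF.
have -> : S `^ p = Th `^ (p - 1) * (m `^ p * Th).
  by rewrite SE powRM ?(ltW Th0)// -(mulr_powRB1 (ltW Th0) p0); ring.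
rewrite ler_wpM2l ?powR_ge0//.
have -> : m `^ p * Th = \sum_(i <- r) th i *
    (m `^ p + p * (m `^ (p - 1) * (a i / th i - m))).
  rewrite (eq_big_seq (fun i => m `^ p * th i + p * m `^ (p - 1) * (a i - m * th i))).
    by rewrite big_split/= -!mulr_sumr sumrB -mulr_sumr -/S -/Th SE subrr mulr0 addr0.
  by move=> i ir; field; rewrite gt_eqF// th0.
rewrite big_seq [leRHS]big_seq; apply: ler_sum => i ir.
have thi := th0 i ir.
have -> : th i `^ (1 - p) * a i `^ p = th i * (a i / th i) `^ p.
  have thp : 0 < th i `^ p by rewrite powR_gt0.
  rewrite powRB; last by rewrite (gt_eqF thi) implybT.
  rewrite powRr1 ?(ltW thi)// powRM ?invr_ge0 ?(ltW thi)//.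
  rewrite -[(th i)^-1](powR_inv1 (ltW thi)) -powRrM mulN1r powRN; ring.
by rewrite ler_wpM2l ?(ltW thi)// powR_tangent// divr_ge0// ltW.
Qed.

End jensen.

Section mean_value.
Local Open Scope ereal_scope.
Context d (T : measurableType d) (R : realType).
Variable mu : {measure set T -> \bar R}.

Lemma integrable_cst_fin (B : set T) (k : R) : measurable B -> mu B < +oo ->
  mu.-integrable B (cst k%:E).
Proof.
move=> mB Boo; apply/integrableP; split; first exact: measurable_cst.
by rewrite /= integral_cst//= lte_mul_pinfty.
Qed.

(* c is the mean of u over B (any value if u is not integrable). *)
Lemma exists_mean (p : R) (B : set T) (u : T -> R) : (1 < p)%R ->
  measurable B -> 0 < mu B -> mu B < +oo -> measurable_fun B u ->
  exists c : R, forall a : R,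
    (`|a - c| `^ p)%:E * mu B <= \int[mu]_(x in B) (`|a - u x| `^ p)%:E.
Proof.
move=> p1 mB B0 Boo mu_; have p0 : (0 < p)%R by exact: lt_trans p1.
have mf (a : R) : measurable_fun B (fun x => (`|a - u x| `^ p)%:E).
  apply/measurable_EFinP; apply: (measurableT_comp (measurable_powR _)).
  by apply: measurableT_comp => //; exact: measurable_funB.
have intf (a : R) : \int[mu]_(x in B) (`|a - u x| `^ p)%:E < +oo ->
    mu.-integrable B (fun x => (`|a - u x| `^ p)%:E).
  move=> h; apply/integrableP; split => //.
  by under eq_integral do rewrite gee0_abs ?lee_fin ?powR_ge0//.
have intu (a : R) : \int[mu]_(x in B) (`|a - u x| `^ p)%:E < +oo ->
    mu.-integrable B (EFin \o u).
  move=> /intf h.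
  (* The majorant of [|u|] is [|a| + 1 + |a - u|^p], where the 1 covers the points with
     [|a - u| <= 1]. *)
  have h2 := integrableD mB (integrable_cst_fin (`|a| + 1) mB Boo) h.
  apply: le_integrable h2 => //; first exact/measurable_EFinP.
  move=> x _; rewrite -[leRHS]/(`| (`|a| + 1 + `|a - u x| `^ p)%:E |) !abse_EFin lee_fin.
  rewrite [leRHS]ger0_norm ?addr_ge0 ?powR_ge0//.
  have : (`|u x| <= `|a| + `|a - u x|)%R.
    by rewrite -[in leLHS](subKr a (u x)) (le_trans (ler_normB _ _)).
  move=> /le_trans; apply; rewrite -addrA lerD2l.
  have [au|au] := leP `|a - u x|%R 1%R.
    by rewrite (le_trans au)// lerDl powR_ge0.
  by rewrite (le_trans (le1r_powR (ltW au) (ltW p1)))// lerDr.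
have [int|nint] := pselect (mu.-integrable B (EFin \o u)); last first.
  (* If [u] is not integrable on [B], the right-hand side is infinite for every [a]. *)
  exists 0%R => a; rewrite leNgt; apply/negP => h; apply: nint; apply: (intu a).
  exact/(lt_le_trans h)/leey.
have Bfin : mu B \is a fin_num by rewrite ge0_fin_numE// ltW.
have ufin : \int[mu]_(x in B) (u x)%:E \is a fin_num by exact: integrable_fin_num.
pose b := fine (mu B); have bE : mu B = b%:E by rewrite fineK.
have b0 : (0 < b)%R by rewrite -lte_fin -bE.
pose c := (fine (\int[mu]_(x in B) (u x)%:E) / b)%R.
have cE : \int[mu]_(x in B) (u x)%:E = (c * b)%:E by rewrite /c mulfVK ?gt_eqF// fineK.
exists c => a.
have [fin|] := ltP (\int[mu]_(x in B) (`|a - u x| `^ p)%:E) +oo; last first.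
  by rewrite leye_eq => /eqP ->; exact: leey.
pose m : R := `|a - c|%R; pose sg := Num.sg (a - c).
pose k1 := (p * m `^ (p - 1))%R.
(* The tangent bound at [m], with [|a - u x|] replaced by the smaller [sg * (a - u x)], is affine in
   [u]; its mean over [B] is [m^p] because [u] has mean [c]. *)
have intk : mu.-integrable B
    (fun x => (m `^ p + k1 * (sg * a - m))%:E + (- (k1 * sg))%:E * (u x)%:E).
  by apply: integrableD => //; [exact: integrable_cst_fin|exact: integrableZl].
apply: (@le_trans _ _ (\int[mu]_(x in B)
   ((m `^ p + k1 * (sg * a - m))%:E + (- (k1 * sg))%:E * (u x)%:E))); last first.
  apply: le_integral => //; first exact: intf.
  move=> x _; rewrite -EFinM -EFinD lee_fin.
  apply: le_trans _ (powR_tangent p1 (normr_ge0 (a - u x)%R) (normr_ge0 (a - c)%R)).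
  rewrite -/m -addrA lerD2l mulrA -/k1.
  have -> : (k1 * (sg * a - m) + - (k1 * sg) * u x = k1 * (sg * (a - u x) - m))%R by ring.
  rewrite ler_wpM2l ?mulr_ge0 ?powR_ge0 ?(ltW p0)// lerD2r.
  apply: le_trans (ler_norm _) _; rewrite normrM ler_piMl// /sg.
  by rewrite normr_sg lern1 leq_b1.
rewrite integralD//; last 2 first.
- exact: integrable_cst_fin.
- exact: integrableZl.
rewrite integral_cst// integralZl// cE bE -!EFinM -EFinD lee_fin -/m.
rewrite le_eqVlt; apply/orP; left; apply/eqP.
have : (sg * (a - c) = m)%R by rewrite /sg /m -normrEsg.
move: (m `^ p)%R => M <-; ring.
Qed.

End mean_value.

(** * Lebesgue measure and powers of the distance to the boundary *)

Section lebesgue_rV_theory.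
Context {R : realType} {n : nat}.
Notation mu := (@lebesgue_rV R n).
Implicit Types (x y : 'rV[R]_n) (E U : set 'rV[R]_n).

Definition cube x (h : R) : set 'rV[R]_n :=
  [set y | forall i, `]x ord0 i - h, x ord0 i + h[%classic (y ord0 i)].

Lemma cubeP x h y : cube x h y <-> forall i, `|y ord0 i - x ord0 i| < h.
Proof.
split=> H i; have := H i; rewrite /= in_itv/= ltr_distl//.
Qed.

Lemma measurable_cube x h : measurable (cube x h).
Proof.
rewrite (_ : cube x h = \bigcap_(i in [set: 'I_n])
    ((fun v : 'rV[R]_n => v ord0 i) @^-1` `]x ord0 i - h, x ord0 i + h[)).
  apply: fin_bigcap_measurable => // i _; rewrite -[X in measurable X]setTI.
  exact: (measurable_coord i measurableT (measurable_itv _)).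
by apply/seteqP; split => v Bv i; [move=> _; exact: Bv|exact: (Bv i)].
Qed.

Lemma lebesgue_cube x h : 0 <= h -> mu (cube x h) = ((2 * h) ^+ n)%:E.
Proof.
move=> h0.
rewrite (@lebesgue_rV_box _ _
  (fun i => `]x ord0 i - h, x ord0 i + h[%classic)); last first.
  by move=> i; exact: measurable_itv.
rewrite (eq_bigr (fun=> (2 * h)%:E)); last first.
  move=> i _; rewrite lebesgue_measure_itv/= lte_fin.
  case: ifPn => [_|]; first by rewrite -EFinB; congr EFin; ring.
  by rewrite -leNgt => h1; congr EFin; lra.
by rewrite prodEFin prodr_const card_ord.
Qed.

Lemma cube_enorm x h y : cube x h y -> enorm (y - x) <= n%:R * h.
Proof.
by move=> /cubeP yh; apply: enorm_le_coord => i; rewrite !mxE ltW.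
Qed.

Lemma eball_sub_cube x r : eball x r `<=` cube x r.
Proof.
move=> y /= yr; apply/cubeP => i; apply: le_lt_trans yr.
by have := ler_coord_enorm (y - x) i; rewrite !mxE.
Qed.

(** The sigma-algebra is generated by the coordinates, so [U] is written as the countable union of
    the cubes with rational centre and half-side [1 / k.+1] that it contains. *)
Lemma open_measurable_rV U : open U -> measurable U.
Proof.
move=> oU.
pose V (qk : 'rV[rat]_n * nat) : set 'rV[R]_n :=
  if `[< cube (map_mx ratr qk.1) (qk.2.+1%:R^-1) `<=` U >]
  then cube (map_mx ratr qk.1) (qk.2.+1%:R^-1) else set0.
rewrite (_ : U = \bigcup_qk V qk).
  apply: countable_bigcupT_measurable => [|qk]; first exact: countableP.
  by rewrite /V; case: ifP => // _; exact: measurable_cube.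
apply/seteqP; split => [x Ux|x [qk _]]; last first.
  by rewrite /V; case: ifP => // /asboolP CU /CU.
have [e e0 xU] := (open_eballP U).1 oU x Ux.
pose N : R := n%:R + 1; have N0 : 0 < N by rewrite ltr_wpDl.
have eN0 : 0 < e / (2 * N) by rewrite divr_gt0// mulr_gt0.
pose k := Num.truncn (e / (2 * N))^-1.
have kE : k.+1%:R^-1 < e / (2 * N).
  rewrite -[ltRHS]invrK ltf_pV2 ?posrE ?invr_gt0//.
  exact: truncnS_gt.
have k0 : 0 < k.+1%:R^-1 :> R by rewrite invr_gt0.
have /choice[q qx] : forall i, exists q : rat, `|ratr q - x ord0 i| < k.+1%:R^-1.
  move=> i; have : x ord0 i - k.+1%:R^-1 < x ord0 i + k.+1%:R^-1.
    by rewrite ltrBlDr -addrA ltrDl addr_gt0.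
  by move=> /rat_in_itvoo[q]; rewrite in_itv/= -ltr_distl; exists q.
exists (\row_i q i, k) => //; rewrite /V /=.
have Cx : cube (map_mx ratr (\row_i q i)) k.+1%:R^-1 x.
  by apply/cubeP => i; rewrite !mxE distrC.
rewrite ifT//; apply/asboolP => y /cubeP Cy; apply: xU => /=.
have /le_lt_trans : enorm (y - x) <= n%:R * (2 * k.+1%:R^-1).
  apply: enorm_le_coord => i; have := Cy i; have := qx i; rewrite !mxE.
  have := ler_distD (ratr (q i)) (y ord0 i) (x ord0 i).
  by move: (k.+1%:R^-1) => h; lra.
apply; have : n%:R * (2 * k.+1%:R^-1) <= N * (2 * k.+1%:R^-1).
  by rewrite ler_wpM2r ?mulr_ge0 ?(ltW k0)// /N lerDl.
move=> /le_lt_trans; apply.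
by rewrite mulrCA mulrA -ltr_pdivlMl ?mulr_gt0// [X in _ < X]mulrC.
Qed.

Lemma enorm_lip_measurable (f : 'rV[R]_n -> R) :
  (forall x y, f x <= f y + enorm (x - y)) -> measurable_fun setT f.
Proof.
move=> lip; apply: (measurability _ (RGenOInfty.measurableE R)).
move=> _ [_ [a ->] <-]; rewrite setTI; apply: open_measurable_rV.
apply/open_eballP => x /=; rewrite in_itv/= andbT => ax.
exists (f x - a); first by rewrite subr_gt0.
move=> y; rewrite /eball/= in_itv/= andbT => yx.
by have := lip x y; rewrite (enormC x y); lra.
Qed.

Lemma measurable_bdist E : boundary E !=set0 -> measurable_fun setT (bdist E).
Proof. by move=> E0; apply: enorm_lip_measurable => x y; exact: dist_to_lip. Qed.

Lemma measurable_enormB d (T : measurableType d) (f g : T -> 'rV[R]_n) :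
  measurable_fun setT f -> measurable_fun setT g ->
  measurable_fun setT (fun t => enorm (f t - g t)).
Proof.
move=> mf mg; rewrite (_ : (fun t => _) =
    (fun r : R => r `^ 2^-1) \o (fun t => \sum_i (f t ord0 i - g t ord0 i) ^+ 2)).
  apply: measurableT_comp; first exact: measurable_powR.
  apply: measurable_sum => i; apply: measurable_funX; apply: measurable_funB.
    exact: (measurableT_comp (measurable_coord i) mf).
  exact: (measurableT_comp (measurable_coord i) mg).
apply/funext => t /=; rewrite powR12_sqrt ?sumr_ge0// => [|i _]; last exact: sqr_ge0.
by congr Num.sqrt; apply: eq_bigr => i _; rewrite !mxE.
Qed.

End lebesgue_rV_theory.

Section auxiliary_estimates.
Context {R : realType}.

Lemma powR_comparable (a b m e : R) : 0 < a -> 0 < b -> 1 <= m ->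
  a <= m * b -> b <= m * a -> a `^ e <= m `^ `|e| * b `^ e.
Proof.
move=> a0 b0 m1 amb bma; have m0 : 0 < m by exact: lt_le_trans m1.
have [e0|e0] := leP 0 e.
  rewrite (ger0_norm e0) -powRM ?(ltW m0) ?(ltW b0)//.
  by rewrite ge0_ler_powR ?nnegrE ?mulr_ge0// ltW.
have [e' e'E] : exists e', e' = - e by eexists.
have -> : e = - e' by rewrite e'E opprK.
have e'0 : 0 <= e' by rewrite e'E oppr_ge0 ltW.
rewrite normrN (ger0_norm e'0) !powRN ler_pdivlMr ?powR_gt0// mulrC.
rewrite ler_pdivrMr ?powR_gt0// -powRM ?(ltW m0) ?(ltW a0)//.
by rewrite ge0_ler_powR ?nnegrE ?mulr_ge0// ltW.
Qed.

Lemma powRXn (a e : R) k : 0 <= a -> (a ^+ k) `^ e = (a `^ e) ^+ k.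
Proof.
by move=> a0; rewrite -(powR_mulrn k a0) powRAC powR_mulrn// powR_ge0.
Qed.

Lemma nneseries_geometric_le (a q : R) : 0 <= a -> 0 <= q -> q < 1 ->
  (\sum_(0 <= k <oo) (a * q ^+ k)%:E <= (a / (1 - q))%:E)%E.
Proof.
move=> a0 q0 q1; apply: lime_le.
  by apply: is_cvg_nneseries => k _ _; rewrite lee_fin mulr_ge0// exprn_ge0.
apply: nearW => N; rewrite sumEFin lee_fin big_mkord -mulr_sumr ler_wpM2l//.
rewrite -[leRHS]mul1r ler_pdivlMr ?subr_gt0//.
have := subrX1 q N; have := exprn_ge0 N q0.
by move: (q ^+ N) (\sum_(i < N) q ^+ i) => Q S; lra.
Qed.

Lemma le_measure_bigsetU d (T : measurableType d)
    (mu : {measure set T -> \bar R}) (I : Type) (s : seq I) (F : I -> set T) :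
  (forall i, measurable (F i)) ->
  (mu (\big[setU/set0]_(i <- s) F i) <= \sum_(i <- s) mu (F i))%E.
Proof.
move=> mF; elim: s => [|i s IH]; first by rewrite !big_nil measure0.
rewrite !big_cons.
apply: (@le_trans _ _ (mu (F i) + mu (\big[setU/set0]_(j <- s) F j))%E).
  by apply: measureU2 => //; exact: bigsetU_measurable.
by rewrite leeD2l.
Qed.

Lemma measurable_set_le d (T : measurableType d) (f g : T -> R) :
  measurable_fun setT f -> measurable_fun setT g ->
  measurable [set x | f x <= g x].
Proof.
move=> mf mg; have := measurable_fun_ler mf mg measurableT (Y := [set true]).
by rewrite setTI; apply.
Qed.

Lemma measurable_set_lt d (T : measurableType d) (f g : T -> R) :
  measurable_fun setT f -> measurable_fun setT g ->
  measurable [set x | f x < g x].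
Proof.
move=> mf mg; have := measurable_fun_ltr mf mg measurableT (Y := [set true]).
by rewrite setTI; apply.
Qed.

Lemma exists_halving (r t : R) : 0 < t -> t <= r ->
  exists k, r * 2^-1 ^+ k.+1 < t /\ t <= r * 2^-1 ^+ k.
Proof.
move=> t0 tr; have r0 : 0 < r by exact: lt_le_trans tr.
have ex : exists k, r * 2^-1 ^+ k.+1 < t.
  exists (Num.truncn (r / t)).
  rewrite exprVn ltr_pdivrMr ?exprn_gt0// mulrC -ltr_pdivrMr//.
  apply: lt_trans (truncnS_gt _) _.
  by rewrite -natrX ltr_nat ltn_expl.
exists (ex_minn ex); case: ex_minnP => k kt kmin; split => //.
case: k kt kmin => [_ _|k kt kmin]; first by rewrite expr0 mulr1.
by rewrite leNgt; apply/negP => /kmin; rewrite ltnn.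
Qed.

End auxiliary_estimates.

Section distance_power.
Context {R : realType} {n : nat}.
Notation mu := (@lebesgue_rV R n).
Variable Omega : set 'rV[R]_n.
Local Notation d := (bdist Omega).

Definition covering_bound (C lam : R) := forall r rho : R, 0 < r -> r < rho ->
  (ereal_sup [set covering_number (eball x rho `&` boundary Omega) r
     | x in boundary Omega] <= (C * (rho / r) `^ lam)%:E)%E.

(** The covering number is an infimum, so an actual cover is found below the bound plus 1; as
    [1 <= (rho / r)^lam], this turns [C] into [C + 1]. *)
Lemma covering_bound_card (C lam r rho : R) (z : 'rV[R]_n) :
  0 <= lam -> covering_bound C lam -> 0 < r -> r < rho -> boundary Omega z ->
  exists k (c : 'I_k -> 'rV[R]_n),
    eball z rho `&` boundary Omega `<=` \bigcup_i eball (c i) r /\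
    k%:R <= (C + 1) * (rho / r) `^ lam.
Proof.
move=> lam0 cov r0 rrho bz.
have h1 : 1 <= (rho / r) `^ lam.
  rewrite -[leLHS](powRr0 (rho / r)) ler_powR//.
  by rewrite ler_pdivlMr// mul1r ltW.
have : (covering_number (eball z rho `&` boundary Omega) r <
    (C * (rho / r) `^ lam + 1)%:E)%E.
  apply: (@le_lt_trans _ _ (C * (rho / r) `^ lam)%:E); last by rewrite lte_fin ltrDl.
  by apply: le_trans (cov _ _ r0 rrho); apply: ereal_sup_ubound; exists z.
move=> /ereal_inf_lt[_ [k [c cE] <-]]; rewrite lte_fin => kC.
by exists k, c; split => //; rewrite (le_trans (ltW kC))// mulrDl mul1r lerD2l.
Qed.

(** A point of [A] is within [2 * r] of a boundary point in the ball about [z0], which lies in one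
    of the covering balls of radius [r]. Hence the cubes of half-side [3 * r] about their centres
    cover [A]. *)
Lemma lebesgue_distance_layer (C lam r rho : R) (z0 : 'rV[R]_n)
    (A : set 'rV[R]_n) :
  0 <= lam -> covering_bound C lam -> 0 < r -> r < rho -> boundary Omega z0 ->
  measurable A -> (forall x, A x -> 0 < d x /\ d x <= r) ->
  (forall x z, A x -> enorm (x - z) < 2 * d x -> enorm (z - z0) < rho) ->
  (mu A <= ((C + 1) * (rho / r) `^ lam * (6 * r) ^+ n)%:E)%E.
Proof.
move=> lam0 cov r0 rrho bz0 mA Ad Az.
have [k [c [cE kC]]] := covering_bound_card lam0 cov r0 rrho bz0.
apply: (@le_trans _ _ (mu (\big[setU/set0]_(i <- enum 'I_k) cube (c i) (3 * r)))).
  apply: le_measure; rewrite ?inE//.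
    by apply: bigsetU_measurable => i _; exact: measurable_cube.
  move=> x Ax; have [dx0 dxr] := Ad x Ax.
  have : dist_to (boundary Omega) x < 2 * d x by rewrite -/(bdist Omega x); lra.
  move=> /dist_to_approx-/(_ (ex_intro _ z0 bz0))[z bz xz].
  have [i _ zi] := cE z (conj (Az x z Ax xz) bz).
  rewrite -bigcup_seq; exists i; first by rewrite /= mem_enum.
  apply: eball_sub_cube; rewrite /eball/=.
  by have := ler_enorm_dist x z (c i); move: zi; rewrite /eball/=; lra.
apply: le_trans (le_measure_bigsetU _ _ _) _; first by move=> i; exact: measurable_cube.
rewrite (eq_bigr (fun=> ((2 * (3 * r)) ^+ n)%:E)); last first.
  by move=> i _; apply: lebesgue_cube; rewrite mulr_ge0// ltW.
rewrite big_enum/= sumEFin lee_fin sumr_const card_ord -[_ *+ k]mulr_natl.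
rewrite (_ : 2 * (3 * r) = 6 * r); last by ring.
by rewrite ler_wpM2r// exprn_ge0// mulr_ge0// ltW.
Qed.

Lemma integral_distance_powR (C lam al M : R) :
  open Omega -> boundary Omega !=set0 -> 0 <= lam -> 0 <= C ->
  covering_bound C lam -> 0 < n%:R + al - lam -> 1 <= M ->
  exists2 K : R, 0 < K & forall y, Omega y ->
    (\int[mu]_(x in Omega `&` [set x | (enorm (x - y) <= M * d y)%R])
       (d x `^ al)%:E <= (K * d y `^ (n%:R + al))%:E)%E.
Proof.
move=> oO bO lam0 C0 cov gap M1.
(* The layer of index [k] contributes a multiple of [q^k]; the gap between [n + al] and [lam] makes
   the series converge. *)
have hq : (2^-1 : R) `^ (n%:R + al - lam) < 1.
  rewrite /powR gt_eqF// -[X in _ < X]expR0 ltr_expR pmulr_rlt0//.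
  by apply: ln_lt0; rewrite invr_gt0 ltr0n/= invf_lt1 ?ltr1n.
set q := _ `^ _ in hq; have q0 : 0 <= q := powR_ge0 _ _.
pose c1 := (2 : R) `^ `|al| * ((C + 1) * 5 `^ lam * 6 ^+ n).
have c10 : 0 < c1.
  by rewrite !mulr_gt0 ?powR_gt0 ?exprn_gt0 ?ltr_wpDl.
have K0 : 0 < c1 * (M + 1) `^ (n%:R + al) / (1 - q).
  by rewrite divr_gt0 ?subr_gt0// mulr_gt0// powR_gt0// addr_gt0//; lra.
exists (c1 * (M + 1) `^ (n%:R + al) / (1 - q)) => // y Oy.
have dy0 := open_bdist_gt0 oO bO Oy.
(* By the Lipschitz property, [r0] bounds the distance to the boundary on the whole domain of
   integration. *)
pose r0 := (M + 1) * d y.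
have r00 : 0 < r0 by rewrite mulr_gt0//; lra.
pose r k := r0 * 2^-1 ^+ k.
have rk0 k : 0 < r k by rewrite mulr_gt0// exprn_gt0// invr_gt0.
have rk k : r k <= r0.
  by rewrite ler_piMr ?(ltW r00)// exprn_ile1 ?invr_ge0// invf_le1 ?ler1n.
have rS k : r k = 2 * r k.+1 by rewrite /r exprS; field.
pose S := Omega `&` [set x | enorm (x - y) <= M * d y].
have mO : measurable Omega by exact: open_measurable_rV.
have md : measurable_fun setT d by exact: measurable_bdist.
have mS : measurable S.
  apply: measurableI => //; apply: measurable_set_le => //.
  exact: measurable_enormB.
pose A k := S `&` [set x | r k.+1 < d x] `&` [set x | d x <= r k].
have mA k : measurable (A k).
  apply: measurableI; first apply: measurableI => //.
    exact: measurable_set_lt.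
  exact: measurable_set_le.
have [z0 bz0 yz0] : exists2 z0, boundary Omega z0 & enorm (y - z0) < 2 * d y.
  by apply: dist_to_approx => //; rewrite -/(bdist Omega y); lra.
have dS x : S x -> 0 < d x /\ d x <= r0.
  move=> [Ox xy]; split; first exact: open_bdist_gt0.
  have := dist_to_lip x y bO; rewrite /= in xy.
  by rewrite -!/(bdist Omega _) /r0; lra.
(* A point within [2 * d x] of [x] is within [2 * r0 + M * d y + 2 * d y] of [z0], which is at most
   [5 * r0]. *)
have muA k : (mu (A k) <= ((C + 1) * ((5 * r0) / r k) `^ lam * (6 * r k) ^+ n)%:E)%E.
  apply: (@lebesgue_distance_layer _ _ _ _ z0) => //.
  - by apply: le_lt_trans (rk k) _; lra.
  - by move=> x [[Sx _] dxr]; have [] := dS x Sx.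
  - move=> x z [[Sx _] _]; have [_ dx] := dS x Sx; case: Sx => _ /= xy xz.
    have := ler_enorm_dist z x z0; have := ler_enorm_dist x y z0.
    have Md : 0 <= M * d y by rewrite mulr_ge0// ?(ltW dy0)//; lra.
    rewrite (enormC z x); move: dx dy0 xy yz0 xz; rewrite /r0; lra.
pose g k x := (((2 : R) `^ `|al| * r k `^ al) * \1_(A k) x)%:E.
have g0 k x : (0 <= g k x)%E by rewrite lee_fin mulr_ge0// mulr_ge0// powR_ge0.
have mg k : measurable_fun setT (g k).
  by apply/measurable_EFinP; apply: measurable_funM => //; exact: measurable_indic.
apply: (@le_trans _ _ (\int[mu]_x (\sum_(0 <= k <oo) g k x))%E).
  apply: ge0_le_integral_subset => //.
  - by move=> x _; rewrite lee_fin powR_ge0.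
  - by move=> x _; exact: nneseries_ge0.
  - move=> x Sx; split=> //; have [dx0 dxr] := dS x Sx.
    have [k [kd dk]] := exists_halving dx0 dxr.
    have Ak : A k x by [].
    apply: le_trans (nneseries_lim_ge k.+1 (fun i _ _ => g0 i x)).
    rewrite big_mkord (bigD1 ord_max)//=.
    apply: (@le_trans _ _ (g k x)); last by rewrite leeDl// sume_ge0.
    rewrite lee_fin indicE mem_set// mulr1.
    apply: powR_comparable => //; first by rewrite ler1n.
      by apply: le_trans dk _; rewrite -/(r k); have := rk0 k; lra.
    by rewrite -/(r k) rS; move: kd; rewrite -/(r k.+1); lra.
rewrite integral_nneseries//.
apply: (@le_trans _ _ (\sum_(0 <= k <oo) ((c1 * r0 `^ (n%:R + al)) * q ^+ k)%:E)%E).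
  apply: lee_nneseries => [k _ _|k _]; first by apply: integral_ge0.
  rewrite /g; under eq_integral do rewrite EFinM.
  rewrite ge0_integralZl//; last 2 first.
  - by apply/measurable_EFinP; exact: measurable_indic.
  - by rewrite lee_fin mulr_ge0// powR_ge0.
  rewrite integral_indic// setIT.
  apply: (le_trans (lee_wpmul2l _ (muA k))).
    by rewrite lee_fin mulr_ge0// powR_ge0.
  rewrite -EFinM lee_fin le_eqVlt; apply/orP; left; apply/eqP.
  rewrite -(powRXn _ k) ?invr_ge0//.
  have h0 : (0 : R) < 2^-1 ^+ k by rewrite exprn_gt0// invr_gt0.
  rewrite /r exprMn; move: (2^-1 ^+ k) h0 => h h0.
  have rh0 : 0 < r0 * h by rewrite mulr_gt0.
  have -> : 5 * r0 / (r0 * h) = 5 * h^-1 by field; rewrite !gt_eqF.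
  rewrite (powRM lam (ler0n _ 5)) ?invr_ge0 ?(ltW h0)//.
  rewrite -(powR_inv1 (ltW h0)) -powRrM mulN1r.
  have -> : n%:R + al - lam = n%:R + (al - lam) by ring.
  rewrite !(powRD (x := h)) ?(gt_eqF h0) ?implybT//.
  rewrite (powRD (x := r0)) ?(gt_eqF r00) ?implybT//.
  rewrite (powRM al (ltW r00) (ltW h0)) !powR_mulrn ?(ltW h0) ?(ltW r00)//.
  by rewrite /c1 exprMn; ring.
apply: le_trans (nneseries_geometric_le _ q0 hq) _.
  by rewrite mulr_ge0// ?(ltW c10)// powR_ge0.
rewrite lee_fin /r0 powRM ?(ltW dy0)//; last by lra.
by rewrite le_eqVlt; apply/orP; left; apply/eqP; field; rewrite gt_eqF// subr_gt0.
Qed.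

End distance_power.

(** * Energy density and local means *)

Section energy_density.
Context {R : realType} {n : nat}.
Notation mu := (@lebesgue_rV R n).
Variables (p s beta tau : R) (Omega : set 'rV[R]_n) (u : 'rV[R]_n -> R).
Hypotheses (n0 : (0 < n)%N) (p1 : 1 < p) (s0 : 0 < s)
  (oO : open Omega) (bO : boundary Omega !=set0) (tau0 : 0 < tau) (tau1 : tau < 1)
  (mu_ : measurable_fun setT u).
Local Notation d := (bdist Omega).
Local Notation N := (n%:R : R).

Definition energy_kernel (y z : 'rV[R]_n) : R :=
  `|u z - u y| `^ p / enorm (z - y) `^ (n%:R + s * p) *
     Num.min (d y) (d z) `^ ((beta + s) * p).

Definition energy_density (y : 'rV[R]_n) : \bar R :=
  \int[mu]_(z in Omega `&` eball y (tau * d y)) (energy_kernel y z)%:E.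

Local Notation G := energy_density.

Let md : measurable_fun setT d := measurable_bdist bO.
Let mO : measurable Omega := open_measurable_rV oO.
Let N0 : 0 < N. Proof. by rewrite ltr0n. Qed.
Let p0 : 0 < p. Proof. exact: lt_trans p1. Qed.

Lemma frac_energyE :
  frac_energy Omega s p beta tau u = (\int[mu]_(y in Omega) G y)%E.
Proof. by []. Qed.

Lemma energy_kernel_ge0 y z : 0 <= energy_kernel y z.
Proof. by rewrite !mulr_ge0 ?invr_ge0 ?powR_ge0. Qed.

Lemma energy_density_ge0 y : (0 <= G y)%E.
Proof. by apply: integral_ge0 => z _; rewrite lee_fin energy_kernel_ge0. Qed.

Lemma measurable_energy_kernel :
  measurable_fun setT (fun yz : 'rV[R]_n * 'rV[R]_n => energy_kernel yz.1 yz.2).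
Proof.
have mp (T : measurableType _) (f : T -> R) e : measurable_fun setT f ->
    measurable_fun setT (fun t => f t `^ e).
  by move=> mf; exact: (measurableT_comp (measurable_powR e) mf).
apply: measurable_funM; first apply: measurable_funM.
- apply: mp; apply: measurableT_comp => //; apply: measurable_funB.
    exact: (measurableT_comp mu_ measurable_snd).
  exact: (measurableT_comp mu_ measurable_fst).
- rewrite (_ : (fun _ => _) = (fun yz : 'rV[R]_n * 'rV[R]_n =>
      enorm (yz.2 - yz.1) `^ (- (n%:R + s * p)))).
    by apply: mp; exact: (measurable_enormB measurable_snd measurable_fst).
  by apply/funext => yz; rewrite powRN.
- apply: mp; apply: measurable_minr.
    exact: (measurableT_comp md measurable_fst).
  exact: (measurableT_comp md measurable_snd).
Qed.

(** The domain of integration moves with [y]; it is encoded as a measurable subset of the product,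
    to which Tonelli's theorem applies. *)
Lemma measurable_energy_density : measurable_fun setT G.
Proof.
pose B := [set yz : 'rV[R]_n * 'rV[R]_n |
  Omega yz.2 /\ enorm (yz.2 - yz.1) < tau * d yz.1].
have mB : measurable B.
  rewrite (_ : B = snd @^-1` Omega `&`
    [set yz | enorm (yz.2 - yz.1) < tau * d yz.1])//.
  apply: measurableI; first by rewrite -[X in measurable X]setTI; exact: measurable_snd.
  apply: measurable_set_lt.
    exact: (measurable_enormB measurable_snd measurable_fst).
  by apply: measurable_funM => //; exact: (measurableT_comp md measurable_fst).
pose f := (fun yz : 'rV[R]_n * 'rV[R]_n => (energy_kernel yz.1 yz.2)%:E) \_ B.
have mf : measurable_fun setT f.
  apply/(measurable_restrictT _ mB); apply: measurable_funTS.
  by apply/measurable_EFinP; exact: measurable_energy_kernel.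
have f0 yz : (0 <= f yz)%E.
  by rewrite /f patchE; case: ifP => // _; rewrite lee_fin energy_kernel_ge0.
rewrite (_ : G = fubini_F mu f).
  exact: measurable_fun_fubini_tonelli_F.
apply/funext => y; rewrite /energy_density integral_mkcond /fubini_F.
apply: eq_integral => z _; rewrite /f !patchE/=.
by congr (if _ then _ else _); apply/idP/idP => /set_mem/= Bz; exact/mem_set.
Qed.

(** For [z] in the half-radius ball, [|z - y|] is less than [tau * d y] and [min (d y) (d z)] lies
    between [d y / 2] and [d y]. The exponent of [d y] is [(N + s * p) - (beta + s) * p = N - beta *
    p]. *)
Lemma local_energy_le (y : 'rV[R]_n) (A : set 'rV[R]_n) : Omega y ->
  A `<=` eball y (tau * d y / 2) ->
  (\int[mu]_(z in A) (`|u y - u z| `^ p)%:E <=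
   (2 `^ `|(beta + s) * p| * tau `^ (N + s * p) * d y `^ (N - beta * p))%:E * G y)%E.
Proof.
move=> Oy AB; have dy0 := open_bdist_gt0 oO bO Oy.
set e := (beta + s) * p.
have ty0 : 0 < tau * d y by rewrite mulr_gt0.
have tyd : tau * d y < d y by rewrite gtr_pMl.
have mk : measurable_fun setT (fun z => (energy_kernel y z)%:E).
  apply/measurable_EFinP.
  exact: (measurableT_comp measurable_energy_kernel (measurable_pair1 y)).
have mD : measurable (Omega `&` eball y (tau * d y)).
  by apply: measurableI => //; apply: measurable_set_lt => //; exact: measurable_enormB.
rewrite -ge0_integralZl//; last 3 first.
- exact: measurable_funTS.
- by move=> z _; rewrite lee_fin energy_kernel_ge0.
- by rewrite lee_fin !mulr_ge0 ?powR_ge0.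
apply: ge0_le_integral_subset.
- by move=> z _; rewrite lee_fin powR_ge0.
- by move=> z _; rewrite mule_ge0 ?lee_fin ?energy_kernel_ge0// !mulr_ge0 ?powR_ge0.
move=> z /AB; rewrite /eball/= => zy.
have zy' : enorm (z - y) < tau * d y by lra.
have Oz : Omega z by apply: (eball_bdist_sub oO Oy); rewrite /eball/=; lra.
split=> //; rewrite -EFinM lee_fin.
(* At [z = y] the kernel divides by zero, but the left-hand side vanishes. *)
have [->|zyN] := eqVneq z y.
  rewrite subrr normr0 powR0 ?gt_eqF//.
  by rewrite mulr_ge0 ?energy_kernel_ge0// !mulr_ge0 ?powR_ge0.
have e0 : 0 < enorm (z - y).
  rewrite lt_neqAle enorm_ge0 andbT eq_sym; apply: contra zyN => /eqP/enorm_eq0.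
  by move/eqP; rewrite subr_eq0.
have dz0 := open_bdist_gt0 oO bO Oz.
have dzy : d y / 2 <= d z.
  by have := dist_to_lip y z bO; rewrite (enormC y) -!/(bdist Omega _); lra.
set m := Num.min (d y) (d z).
have m0 : 0 < m by rewrite lt_min dy0 dz0.
have my : m <= d y by rewrite ge_min lexx.
have ym : d y / 2 <= m by rewrite le_min dzy andbT; lra.
rewrite /energy_kernel -/m -/e distrC; clearbody m.
set X := `|u z - u y| `^ p; have X0 : 0 <= X := powR_ge0 _ _.
have h1 : enorm (z - y) `^ (N + s * p) <= (tau * d y) `^ (N + s * p).
  rewrite ge0_ler_powR ?nnegrE ?enorm_ge0 ?(ltW ty0) ?(ltW zy')//.
  by rewrite addr_ge0// mulr_ge0// ltW.
have h2 : 1 <= 2 `^ `|e| * d y `^ (- e) * m `^ e.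
  rewrite [leLHS](_ : 1 = m `^ (- e) * m `^ e); last first.
    by rewrite -powRD ?(gt_eqF m0) ?implybT// addNr powRr0.
  rewrite ler_wpM2r ?powR_ge0// -[`|e|]normrN.
  by apply: powR_comparable => //; lra.
have E0 : 0 < enorm (z - y) `^ (N + s * p) by rewrite powR_gt0.
rewrite powRM ?(ltW tau0) ?(ltW dy0)// in h1.
have dyE : d y `^ (N - beta * p) = d y `^ (N + s * p) * d y `^ (- e).
  rewrite -powRD ?(gt_eqF dy0) ?implybT//; congr (_ `^ _); rewrite /e; ring.
rewrite dyE.
move: h1 h2 E0 X0.
move: (enorm (z - y) `^ _) (2 `^ _) (tau `^ _) (d y `^ _) (d y `^ _) (m `^ _) X.
move=> a b c g f h X h1 h2 a0 X0.
have -> : b * c * (f * g) * (X / a * h) = (b * g * h) * ((c * f) / a * X).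
  by field; rewrite gt_eqF.
have : 1 <= c * f / a by rewrite ler_pdivlMr// mul1r.
move=> h3; apply: le_trans (_ : 1 * (1 * X) <= _); first by rewrite !mul1r.
by rewrite ler_pM// ?mul1r// ler_peMl.
Qed.

End energy_density.

Section local_means.
Context {R : realType} {n : nat}.
Notation mu := (@lebesgue_rV R n).
Variables (p s beta tau : R) (Omega : set 'rV[R]_n) (u : 'rV[R]_n -> R).
Hypotheses (n0 : (0 < n)%N) (p1 : 1 < p) (s0 : 0 < s)
  (oO : open Omega) (bO : boundary Omega !=set0) (tau0 : 0 < tau) (tau1 : tau < 1)
  (mu_ : measurable_fun setT u).
Local Notation d := (bdist Omega).
Local Notation N := (n%:R : R).
Local Notation G := (energy_density p s beta tau Omega u).

Let md : measurable_fun setT d := measurable_bdist bO.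
Let mO : measurable Omega := open_measurable_rV oO.
Let N0 : 0 < N. Proof. by rewrite ltr0n. Qed.
Let p0 : 0 < p. Proof. exact: lt_trans p1. Qed.
Let d0 x : Omega x -> 0 < d x. Proof. exact: open_bdist_gt0. Qed.
Let dlip x y : d x <= d y + enorm (x - y). Proof. exact: dist_to_lip. Qed.
Let G0 y : (0 <= G y)%E. Proof. exact: energy_density_ge0. Qed.
Let mG : measurable_fun setT G. Proof. exact: measurable_energy_density. Qed.

(** The divisor [32 * N] puts the cube in the Euclidean ball of radius [tau * d x / 32], small
    enough for the cubes of a separated chain to be disjoint. *)
Definition small_cube x := cube x (tau * d x / (32 * N)).

Lemma small_cube_enorm x y : small_cube x y -> enorm (y - x) <= tau * d x / 32.
Proof.
move=> /cube_enorm/le_trans; apply; rewrite le_eqVlt; apply/orP; left; apply/eqP.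
by field; rewrite gt_eqF.
Qed.

Lemma small_cube_dist x y : Omega x -> small_cube x y ->
  [/\ Omega y, d x <= 2 * d y & d y <= 2 * d x].
Proof.
move=> Ox /small_cube_enorm xy; have dx0 := d0 Ox.
have tdx : tau * d x <= d x by rewrite ler_piMl// ltW.
split; last 2 first.
- by have := dlip x y; rewrite enormC; lra.
- by have := dlip y x; lra.
by apply: (eball_bdist_sub oO Ox); rewrite /eball/=; lra.
Qed.

Lemma lebesgue_small_cube x : Omega x ->
  mu (small_cube x) = (tau `^ N * d x `^ N / (16 * N) `^ N)%:E.
Proof.
move=> Ox; have dx0 := d0 Ox; rewrite lebesgue_cube; last first.
  by rewrite divr_ge0 ?mulr_ge0 ?ltW.
rewrite !powR_mulrn ?mulr_ge0 ?(ltW tau0) ?(ltW dx0)// -exprMn -expr_div_n.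
by congr (_ ^+ _)%:E; field; rewrite gt_eqF.
Qed.

Lemma exists_local_means : exists c : 'rV[R]_n -> R, forall x, Omega x ->
  forall a : R, ((`|a - c x| `^ p)%:E * mu (small_cube x) <=
    \int[mu]_(y in small_cube x) (`|a - u y| `^ p)%:E)%E.
Proof.
suff /choice[c cP] : forall x, exists c, Omega x -> forall a : R,
    ((`|a - c| `^ p)%:E * mu (small_cube x) <=
    \int[mu]_(y in small_cube x) (`|a - u y| `^ p)%:E)%E by exists c.
move=> x; have [Ox|nOx] := pselect (Omega x); last by exists 0.
have mQ := lebesgue_small_cube Ox.
have mQ0 : (0 < mu (small_cube x))%E.
  by rewrite mQ lte_fin divr_gt0 ?mulr_gt0 ?powR_gt0 ?mulr_gt0 ?d0.
have mQoo : (mu (small_cube x) < +oo)%E by rewrite mQ ltry.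
have [c cP] := exists_mean p1 (measurable_cube _ _) mQ0 mQoo (measurable_funTS mu_).
by exists c.
Qed.

Variable c : 'rV[R]_n -> R.
Hypothesis cP : forall x, Omega x -> forall a : R,
  ((`|a - c x| `^ p)%:E * mu (small_cube x) <=
    \int[mu]_(y in small_cube x) (`|a - u y| `^ p)%:E)%E.

(** The mean inequality with [a := u y] is followed by the local energy bound at [y]. Dividing by
    the measure of the cube cancels [tau^N] and, since [d y <= 2 * d x], also [d y^N]. *)
Lemma point_local_mean y x : Omega y -> Omega x ->
  small_cube x `<=` eball y (tau * d y / 2) -> d y <= 2 * d x ->
  ((`|u y - c x| `^ p)%:E <=
   (2 `^ `|(beta + s) * p| * (32 * N) `^ N * tau `^ (s * p) *
    d y `^ (- (beta * p)))%:E * G y)%E.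
Proof.
move=> Oy Ox xy dyx; have dy0 := d0 Oy; have dx0 := d0 Ox.
have b0 : 0 < tau `^ N * d x `^ N / (16 * N) `^ N.
  by rewrite divr_gt0 ?mulr_gt0 ?powR_gt0 ?mulr_gt0.
have := le_trans (cP Ox (u y)) (local_energy_le beta p1 s0 oO bO tau0 tau1 mu_ Oy xy).
rewrite lebesgue_small_cube// -lee_pdivlMr// muleAC => /le_trans; apply.
rewrite -EFinM lee_wpmul2r// lee_fin.
have h : d y `^ N <= 2 `^ N * d x `^ N.
  by rewrite -powRM ?(ltW dx0)// ge0_ler_powR ?nnegrE ?mulr_ge0 ?(ltW dx0) ?(ltW dy0).
rewrite ler_pdivrMr//.
have -> : 32 * N = 2 * (16 * N) by ring.
rewrite [(2 * _) `^ N]powRM ?mulr_ge0 ?(ltW N0)//.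
rewrite !powRD ?(gt_eqF tau0) ?(gt_eqF dy0) ?implybT//.
have N16 : 0 < (16 * N) `^ N by rewrite powR_gt0// mulr_gt0.
have T0 : 0 < tau `^ N by rewrite powR_gt0.
have B0 := powR_ge0 (d y) (- (beta * p)).
have A0 := powR_ge0 tau (s * p).
have C0 := powR_ge0 2 `|(beta + s) * p|.
move: (d x `^ N) (d y `^ N) (2 `^ N) (tau `^ N) ((16 * N) `^ N) (d y `^ (- (beta * p)))
  (tau `^ (s * p)) (2 `^ `|(beta + s) * p|) h N16 T0 B0 A0 C0
  => dx dy t T S B A C h S0 T0 B0 A0 C0.
have -> : C * (t * S) * A * B * (T * dx / S) = (C * A * B * T) * (t * dx).
  by field; rewrite gt_eqF.
have -> : C * (T * A) * (dy * B) = (C * A * B * T) * dy by ring.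
by rewrite ler_wpM2l// !mulr_ge0// ltW.
Qed.

Lemma own_local_mean x : Omega x ->
  ((`|u x - c x| `^ p)%:E <=
   (2 `^ `|(beta + s) * p| * (32 * N) `^ N * tau `^ (s * p) *
    d x `^ (- (beta * p)))%:E * G x)%E.
Proof.
move=> Ox; have dx0 := d0 Ox; have tdx : 0 < tau * d x by rewrite mulr_gt0.
apply: point_local_mean => //; last by lra.
by move=> z /small_cube_enorm; rewrite /eball/=; lra.
Qed.

(** The mean inequality on the cube of [x] with [a := c x'] reduces the claim to [|u y - c x'|] for
    [y] in that cube, and the cube of [x'] lies in the half-radius ball of each such [y]. The extra
    [tau^-N] and [d y^-N] come from the measure of the cube. *)
Lemma linked_local_means x x' : Omega x -> Omega x' -> chain_link Omega tau x x' ->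
  ((`|c x - c x'| `^ p)%:E <= \int[mu]_(y in small_cube x)
   ((2 `^ `|(beta + s) * p| * (32 * N) `^ N * (32 * N) `^ N *
     tau `^ (s * p - N) * d y `^ (- N - beta * p))%:E * G y))%E.
Proof.
move=> Ox Ox'; rewrite /chain_link => xx'.
have dx0 := d0 Ox; have dx'0 := d0 Ox'.
have tdx : 0 < tau * d x by rewrite mulr_gt0.
have tdx' : 0 < tau * d x' by rewrite mulr_gt0.
have tdx1 : tau * d x <= d x by rewrite ler_piMl// ltW.
have dxx' : d x <= d x' + tau * d x / 8 by have := dlip x x'; rewrite enormC; lra.
have dx'x : d x' <= d x + tau * d x / 8 by have := dlip x' x; lra.
have tdx'x : tau * d x' <= tau * (d x + d x / 8) by rewrite ler_wpM2l ?(ltW tau0)//; lra.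
have b0 : 0 < tau `^ N * d x `^ N / (16 * N) `^ N.
  by rewrite divr_gt0 ?mulr_gt0 ?powR_gt0 ?mulr_gt0.
pose k := 2 `^ `|(beta + s) * p| * (32 * N) `^ N * tau `^ (s * p).
have k0 : 0 <= k by rewrite !mulr_ge0 ?powR_ge0.
have mH e : measurable_fun setT (fun y => (d y `^ e)%:E * G y)%E.
  apply: emeasurable_funM => //; apply/measurable_EFinP.
  exact: (measurableT_comp (measurable_powR e) md).
have mQ : measurable (small_cube x) := measurable_cube _ _.
have step1 : ((`|c x' - c x| `^ p)%:E * mu (small_cube x) <=
    \int[mu]_(y in small_cube x) (k%:E * ((d y `^ (- (beta * p)))%:E * G y)))%E.
  apply: le_trans (cP Ox (c x')) _; apply: ge0_le_integral_subset.
  - by move=> y _; rewrite lee_fin powR_ge0.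
  - by move=> y _; rewrite mule_ge0 ?lee_fin// mule_ge0// lee_fin powR_ge0.
  move=> y xy; split => //; have [Oy dxy dyx] := small_cube_dist Ox xy.
  rewrite distrC muleA -EFinM; have {}xy := small_cube_enorm xy.
  have dxy' := dlip x y; rewrite enormC in dxy'.
  have tdxy : tau * d x <= tau * (d y + d x / 32) by rewrite ler_wpM2l ?(ltW tau0)//; lra.
  apply: point_local_mean => //; last first.
    have := dlip y x'; have := ler_enorm_dist y x x'.
    by rewrite (enormC x x'); lra.
  move=> z /small_cube_enorm zx'; rewrite /eball/=.
  have := ler_enorm_dist z x' y; have := ler_enorm_dist x' x y; rewrite (enormC x y).
  lra.
rewrite distrC.
move: step1; rewrite lebesgue_small_cube// -lee_pdivlMr// => /le_trans; apply.
rewrite muleC -ge0_integralZl//; last 3 first.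
- by apply: measurable_funTS; exact: measurable_funeM.
- by move=> y _; rewrite mule_ge0 ?lee_fin// mule_ge0// lee_fin powR_ge0.
- by rewrite lee_fin invr_ge0 ltW.
apply: ge0_le_integral_subset.
- move=> y _; rewrite mule_ge0 ?lee_fin ?invr_ge0 ?(ltW b0)// mule_ge0 ?lee_fin//.
  by rewrite mule_ge0// lee_fin powR_ge0.
- by move=> y _; rewrite mule_ge0// lee_fin !mulr_ge0 ?powR_ge0.
move=> y xy; split => //; have [Oy dxy dyx] := small_cube_dist Ox xy.
have dy0 := d0 Oy.
rewrite !muleA -!EFinM lee_wpmul2r// lee_fin /k.
have h : d y `^ N <= 2 `^ N * d x `^ N.
  by rewrite -powRM ?(ltW dx0)// ge0_ler_powR ?nnegrE ?mulr_ge0 ?(ltW dx0) ?(ltW dy0).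
rewrite !powRD ?(gt_eqF tau0) ?(gt_eqF dy0) ?implybT// !(powRN _ N).
have -> : 32 * N = 2 * (16 * N) by ring.
rewrite [(2 * _) `^ N]powRM ?mulr_ge0 ?(ltW N0)//.
have N16 : 0 < (16 * N) `^ N by rewrite powR_gt0// mulr_gt0.
have T0 : 0 < tau `^ N by rewrite powR_gt0.
have X0 : 0 < d x `^ N by rewrite powR_gt0.
have Y0 : 0 < d y `^ N by rewrite powR_gt0.
have t0 : 0 < (2 : R) `^ N by rewrite powR_gt0.
have B0 := powR_ge0 (d y) (- (beta * p)).
have A0 := powR_ge0 tau (s * p).
have C0 := powR_ge0 2 `|(beta + s) * p|.
move: (d x `^ N) (d y `^ N) (2 `^ N) (tau `^ N) ((16 * N) `^ N) (d y `^ (- (beta * p)))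
  (tau `^ (s * p)) (2 `^ `|(beta + s) * p|) h N16 T0 X0 Y0 t0 B0 A0 C0
  => dx dy t T S B A C h S0 T0 X0 Y0 t0 B0 A0 C0.
have -> : (T * dx / S)^-1 * (C * (t * S) * A) * B = (C * A * B * t * S * S / T) * dx^-1.
  by field; rewrite !gt_eqF.
have -> : C * (t * S) * (t * S) * (A * T^-1) * (dy^-1 * B) =
    (C * A * B * t * S * S / T) * (t * dy^-1).
  by field; rewrite !gt_eqF.
rewrite ler_wpM2l// ?divr_ge0 ?mulr_ge0// ?(ltW t0) ?(ltW S0) ?(ltW T0)//.
by rewrite ler_pdivlMr// mulrC ler_pdivrMr.
Qed.

End local_means.

(** * Summation along a chain *)

Section disjoint_integrals.
Local Open Scope ereal_scope.

Lemma sum_integral_disjoint d (T : measurableType d) (R : realType)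
    (mu : {measure set T -> \bar R}) (I : eqType) (F : I -> set T) (s : seq I)
    (D : set T) (f : T -> \bar R) :
  (forall i, measurable (F i)) -> measurable D -> measurable_fun D f ->
  (forall x, D x -> 0 <= f x) -> {in s, forall i, F i `<=` D} ->
  pairwise (fun i j => [disjoint F i & F j]) s ->
  \sum_(i <- s) \int[mu]_(x in F i) f x <= \int[mu]_(x in D) f x.
Proof.
move=> mF; elim: s D => [|i s IH] D mD mf f0 FD.
  by rewrite big_nil => _; exact: integral_ge0.
rewrite pairwise_cons => /andP[/allP is_ pws]; rewrite big_cons.
have iD : F i `<=` D by apply: FD; rewrite mem_head.
rewrite -[in leRHS](setDUK iD) ge0_integral_setU//; last 4 first.
- exact: measurableD.
- by rewrite setDUK.
- by rewrite setDUK.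
- by rewrite disj_set2E setDIK.
rewrite leeD2l// IH//.
- exact: measurableD.
- by apply: measurable_funS mf => // x [].
- by move=> x [Dx _]; exact: f0.
- move=> j js x Fjx; split; first by apply: FD Fjx; rewrite inE js orbT.
  by move=> Fix; move: (is_ j js); rewrite disj_set2E => /eqP/seteqP[/(_ x)+ _]; apply.
Qed.

End disjoint_integrals.

Section consecutive_pairs.
Variables (T : eqType).

(** The links of the chain [x :: s] closed by [z]; sums over links are reindexed by their first
    points, which are exactly [x :: s]. *)
Definition consecutive (x : T) (s : seq T) (z : T) := zip (x :: s) (rcons s z).

Lemma unzip1_consecutive x s z : unzip1 (consecutive x s z) = x :: s.
Proof. by rewrite unzip1_zip//= size_rcons. Qed.

Lemma consecutive_rel (e : rel T) x s z : path e x s -> e (last x s) z ->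
  {in consecutive x s z, forall q, e q.1 q.2}.
Proof.
elim: s x => [|y s IH] x /=.
  by move=> _ xz q; rewrite inE => /eqP ->.
move=> /andP[xy ys] lz q; rewrite inE => /predU1P[->//|qs].
exact: IH ys lz q qs.
Qed.

Lemma consecutive_mem x s z q : q \in consecutive x s z ->
  q.1 \in x :: s /\ (q.2 \in s \/ q.2 = z).
Proof.
move=> qs; split; first by rewrite -(unzip1_consecutive x s z) map_f.
have : q.2 \in unzip2 (consecutive x s z) by rewrite map_f.
rewrite unzip2_zip ?size_rcons// mem_rcons inE => /predU1P[->|]; by [right|left].
Qed.

Lemma ler_dist_consecutive (R : realType) (c : T -> R) x s z :
  `|c x - c z| <= \sum_(q <- consecutive x s z) `|c q.1 - c q.2|.
Proof.
elim: s x => [|y s IH] x; first by rewrite /consecutive /= big_seq1.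
rewrite /consecutive/= big_cons; apply: le_trans (ler_distD (c y) _ _) _.
by rewrite lerD2l; exact: IH.
Qed.

End consecutive_pairs.

Section chain_estimate.
Context {R : realType} {n : nat}.
Notation mu := (@lebesgue_rV R n).
Variables (p s beta tau : R) (Omega : set 'rV[R]_n) (u : 'rV[R]_n -> R).
Hypotheses (n0 : (0 < n)%N) (p1 : 1 < p) (s0 : 0 < s)
  (oO : open Omega) (bO : boundary Omega !=set0) (tau0 : 0 < tau) (tau1 : tau < 1)
  (mu_ : measurable_fun setT u).
Local Notation d := (bdist Omega).
Local Notation N := (n%:R : R).
Local Notation G := (energy_density p s beta tau Omega u).
Local Notation Q := (small_cube tau Omega).

Let md : measurable_fun setT d := measurable_bdist bO.
Let mO : measurable Omega := open_measurable_rV oO.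
Let d0 x : Omega x -> 0 < d x. Proof. exact: open_bdist_gt0. Qed.
Let dlip x y : d x <= d y + enorm (x - y). Proof. exact: dist_to_lip. Qed.
Let G0 y : (0 <= G y)%E. Proof. exact: energy_density_ge0. Qed.
Let mG : measurable_fun setT G. Proof. exact: measurable_energy_density. Qed.

(** A common point would give [|y - x| <= tau * (d x + d y) / 32]; since
    [tau * d y <= tau * d x + |y - x|], this is below the separation [tau * d x / 8]. *)
Lemma chain_sep_disjoint x y : Omega x -> Omega y -> chain_sep Omega tau x y ->
  [disjoint Q x & Q y].
Proof.
move=> Ox Oy; rewrite /chain_sep => sep; rewrite disj_set2E; apply/eqP.
apply/seteqP; split => // z [/(small_cube_enorm n0) zx /(small_cube_enorm n0) zy].
have tdx : 0 < tau * d x by rewrite mulr_gt0// d0.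
have := ler_enorm_dist y z x; rewrite (enormC y z).
have : tau * d y <= tau * (d x + enorm (y - x)) by rewrite ler_wpM2l ?(ltW tau0).
have : tau * enorm (y - x) <= enorm (y - x) by rewrite ler_piMl ?enorm_ge0// ltW.
lra.
Qed.

(** Contains the cubes of the chains that start at [x]. The bound is in terms of [d y], so that
    after the exchange of integrals [x] ranges over a ball of radius [M * d y]. *)
Definition visible_set (M : R) x := Omega `&` [set y | enorm (x - y) <= M * d y].

Lemma measurable_visible_set M x : measurable (visible_set M x).
Proof.
apply: measurableI => //; apply: measurable_set_le; first exact: measurable_enormB.
exact: measurable_funM.
Qed.

Variable c : 'rV[R]_n -> R.
Hypothesis cP : forall x, Omega x -> forall a : R,
  ((`|a - c x| `^ p)%:E * mu (Q x) <=
    \int[mu]_(y in Q x) (`|a - u y| `^ p)%:E)%E.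

(** The triangle inequality along the chain, Hölder's inequality with the weights [d q^-e], whose
    sum is at most [T], and the bound for linked means reduce the claim to a sum of integrals over
    the disjoint cubes. *)
Lemma chain_local_means (e C T : R) x x0 r : 0 < e -> 0 <= C ->
  Omega x0 -> path (chain_link Omega tau) x r ->
  chain_link Omega tau (last x r) x0 -> pairwise (chain_sep Omega tau) (x :: r) ->
  {in x :: r, forall q, Omega q /\ enorm (q - x) <= C * d q} ->
  \sum_(q <- x :: r) d q `^ (- e) <= T ->
  ((`|c x - c x0| `^ p)%:E <= (T `^ (p - 1))%:E *
    \int[mu]_(y in visible_set (2 * (C + 1)) x)
     ((2 `^ `|e * (p - 1)| * (2 `^ `|(beta + s) * p| * (32 * N) `^ N * (32 * N) `^ N *
       tau `^ (s * p - N)) * d y `^ (e * (p - 1) - N - beta * p))%:E * G y))%E.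
Proof.
move=> e0 C0 Ox0 pr lr sep rO rT.
have p0 : 0 < p by exact: lt_trans p1.
set K := 2 `^ `|_| * _ * _ * _; have K0 : 0 <= K by rewrite !mulr_ge0 ?powR_ge0.
set ep := e * (p - 1).
pose H y := ((2 `^ `|ep| * K * d y `^ (ep - N - beta * p))%:E * G y)%E.
have mpd e' : measurable_fun setT (fun y => d y `^ e').
  exact: (measurableT_comp (measurable_powR e') md).
have mH : measurable_fun setT H.
  by apply: emeasurable_funM => //; apply/measurable_EFinP; exact: measurable_funM.
have H0 y : (0 <= H y)%E by rewrite mule_ge0// lee_fin !mulr_ge0// powR_ge0.
pose th (q : 'rV[R]_n * 'rV[R]_n) := d q.1 `^ (- e).
pose a (q : 'rV[R]_n * 'rV[R]_n) := `|c q.1 - c q.2|.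
set P := consecutive x r x0.
have PO : {in P, forall q, [/\ Omega q.1, Omega q.2 & chain_link Omega tau q.1 q.2]}.
  move=> q qP; have [q1 q2] := consecutive_mem qP; split.
  - by have [] := rO _ q1.
  - case: q2 => [q2|->//]; have q2r : q.2 \in x :: r by rewrite in_cons q2 orbT.
    by have [] := rO _ q2r.
  - exact: consecutive_rel pr lr q qP.
have th0 : {in P, forall q, 0 < th q}.
  by move=> q /PO[Oq _ _]; rewrite powR_gt0// d0.
have sumth : \sum_(q <- P) th q = \sum_(q <- x :: r) d q `^ (- e).
  by rewrite -(unzip1_consecutive x r x0) big_map.
have main := weighted_power_mean p1 th0 (fun q => normr_ge0 (c q.1 - c q.2)).
have h1 : `|c x - c x0| `^ p <= T `^ (p - 1) * \sum_(q <- P) th q `^ (1 - p) * a q `^ p.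
  apply: le_trans (_ : (\sum_(q <- P) a q) `^ p <= _).
    rewrite ge0_ler_powR ?nnegrE ?(ltW p0)//.
      by apply: sumr_ge0 => q _; exact: normr_ge0.
    exact: ler_dist_consecutive.
  apply: le_trans main _; rewrite ler_wpM2r//.
    by apply: sumr_ge0 => q _; rewrite mulr_ge0 ?powR_ge0.
  have S0 : 0 <= \sum_(q <- P) th q by apply: sumr_ge0 => q _; exact: powR_ge0.
  rewrite sumth in S0 *.
  by rewrite ge0_ler_powR ?nnegrE ?subr_ge0 ?(ltW p1) ?(le_trans S0 rT).
apply: (@le_trans _ _ ((T `^ (p - 1))%:E *
    (\sum_(q <- P) th q `^ (1 - p) * a q `^ p)%:E)%E).
  by rewrite -EFinM lee_fin.
rewrite lee_wpmul2l ?lee_fin ?powR_ge0// -sumEFin.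
apply: (@le_trans _ _ (\sum_(q <- x :: r) \int[mu]_(y in Q q) H y)%E); last first.
  apply: sum_integral_disjoint => //.
  - by move=> q; exact: measurable_cube.
  - exact: measurable_visible_set.
  - exact: measurable_funTS.
  (* The radius [2 * (C + 1)]: [|x - y|] is at most [C * d q + tau * d q / 32], and [d q <= 2 * d y]
     in the cube of [q]. *)
  - move=> q /rO[Oq qx] y qy.
    have [Oy dqy dyq] := small_cube_dist n0 oO bO tau1 Oq qy.
    split=> //=; have {}qy := small_cube_enorm n0 qy.
    have tdq : tau * d q <= d q by rewrite ler_piMl ?(ltW (d0 Oq))// ltW.
    have : C * d q <= C * (2 * d y) by rewrite ler_wpM2l.
    have := ler_enorm_dist x q y; rewrite (enormC x q) (enormC q y).
    by have := d0 Oy; lra.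
  - apply: (sub_in_pairwise (P := [in x :: r])) sep; last exact/allP.
    move=> q q' /rO[Oq _] /rO[Oq' _]; exact: chain_sep_disjoint.
rewrite -(unzip1_consecutive x r x0) big_map big_seq [leRHS]big_seq.
apply: lee_sum => q /PO[Oq1 Oq2 lq].
have link := linked_local_means beta n0 p1 s0 oO bO tau0 tau1 mu_ cP Oq1 Oq2 lq.
rewrite EFinM; apply: (le_trans (lee_wpmul2l _ link)); first by rewrite lee_fin powR_ge0.
rewrite -ge0_integralZl; last 4 first.
- exact: measurable_cube.
- apply: measurable_funTS; apply: emeasurable_funM => //.
  by apply/measurable_EFinP; exact: measurable_funM.
- by move=> y _; rewrite mule_ge0// lee_fin !mulr_ge0 ?powR_ge0.
- by rewrite lee_fin powR_ge0.
apply: ge0_le_integral_subset => //.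
  move=> y _; rewrite mule_ge0 ?lee_fin ?powR_ge0// mule_ge0//.
  by rewrite lee_fin !mulr_ge0 ?powR_ge0.
move=> y qy; split=> //; have [Oy dqy dyq] := small_cube_dist n0 oO bO tau1 Oq1 qy.
rewrite muleA -EFinM lee_wpmul2r// lee_fin -/K.
have dy0 := d0 Oy; have dq0 := d0 Oq1.
(* The Hölder factor is a power of [d q.1], which is comparable to [d y] on the cube and can be
   moved under the integral. *)
have -> : th q `^ (1 - p) = d q.1 `^ ep.
  by rewrite /th -powRrM; congr (_ `^ _); rewrite /ep; ring.
have hq : d q.1 `^ ep <= 2 `^ `|ep| * d y `^ ep.
  by apply: powR_comparable => //; rewrite ler1n.
have -> : ep - N - beta * p = ep + (- N - beta * p) by ring.
rewrite [d y `^ (ep + _)]powRD ?(gt_eqF dy0) ?implybT//.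
have -> : forall a b c' e : R, a * b * (c' * e) = (a * c') * (b * e) by move=> *; ring.
by rewrite ler_wpM2r// mulr_ge0// powR_ge0.
Qed.

End chain_estimate.

(** * Exchange of the integrals over a relation *)

Section tonelli_relation.
Local Open Scope ereal_scope.
Context d (T : measurableType d) (R : realType).
Variable mu : {sigma_finite_measure set T -> \bar R}.
Variables (D : set T) (B : set (T * T)) (f g : T -> \bar R).
Hypotheses (mD : measurable D) (mB : measurable B)
  (mf : measurable_fun setT f) (mg : measurable_fun setT g)
  (f0 : forall x, 0 <= f x) (g0 : forall x, 0 <= g x).

Let E := (D `*` D) `&` B.
Let h := (fun xy : T * T => f xy.1 * g xy.2) \_ E.

Let mE : measurable E.
Proof. by apply: measurableI => //; exact: measurableX. Qed.

Let mh : measurable_fun setT h.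
Proof.
apply/(measurable_restrictT _ mE); apply: measurable_funTS.
apply: emeasurable_funM.
  exact: (measurableT_comp mf measurable_fst).
exact: (measurableT_comp mg measurable_snd).
Qed.

Let h0 xy : 0 <= h xy.
Proof. by rewrite /h patchE; case: ifP => // _; exact: mule_ge0. Qed.

Let section1 x : \int[mu]_y h (x, y) =
  ((fun x => f x * \int[mu]_(y in D `&` [set y | B (x, y)]) g y) \_ D) x.
Proof.
have mDx : measurable (D `&` [set y | B (x, y)]).
  apply: measurableI => //; rewrite -[X in measurable X]setTI.
  exact: (measurable_pair1 x).
rewrite patchE; case: ifPn => [/set_mem Dx|xD]; last first.
  rewrite integral0_eq// => y _; rewrite /h patchE ifF//.
  by apply: contraNF xD => /set_mem[[Dx _] _]; exact/mem_set.
rewrite -ge0_integralZl//; last exact: measurable_funTS.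
rewrite [RHS]integral_mkcond; apply: eq_integral => y _; rewrite /h !patchE.
congr (if _ then _ else _); apply/idP/idP => /set_mem.
  by move=> [[_ Dy] Bxy]; apply/mem_set; split.
by move=> [Dy Bxy]; apply/mem_set; split.
Qed.

Let section2 y : \int[mu]_x h (x, y) =
  ((fun y => g y * \int[mu]_(x in D `&` [set x | B (x, y)]) f x) \_ D) y.
Proof.
have mDy : measurable (D `&` [set x | B (x, y)]).
  apply: measurableI => //; rewrite -[X in measurable X]setTI.
  exact: (measurable_pair2 y).
rewrite patchE; case: ifPn => [/set_mem Dy|yD]; last first.
  rewrite integral0_eq// => x _; rewrite /h patchE ifF//.
  by apply: contraNF yD => /set_mem[[_ Dy] _]; exact/mem_set.
rewrite -ge0_integralZl//; last exact: measurable_funTS.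
rewrite [RHS]integral_mkcond; apply: eq_integral => x _; rewrite /h !patchE/= muleC.
congr (if _ then _ else _); apply/idP/idP => /set_mem.
  by move=> [[Dx _] Bxy]; apply/mem_set; split.
by move=> [Dx Bxy]; apply/mem_set; split.
Qed.

Lemma measurable_relation_integral :
  measurable_fun D (fun x => f x * \int[mu]_(y in D `&` [set y | B (x, y)]) g y).
Proof.
apply/(measurable_restrictT _ mD); rewrite (_ : _ \_ _ = fubini_F mu h).
  exact: measurable_fun_fubini_tonelli_F.
by apply/funext => x; rewrite -section1.
Qed.

(** Both sides are iterated integrals of [h], the product of [f] and [g] cut off outside [E], so
    Tonelli's theorem on the full product space applies. *)
Lemma tonelli_relation :
  \int[mu]_(x in D) (f x * \int[mu]_(y in D `&` [set y | B (x, y)]) g y) =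
  \int[mu]_(y in D) (g y * \int[mu]_(x in D `&` [set x | B (x, y)]) f x).
Proof.
rewrite integral_mkcond [RHS]integral_mkcond.
under eq_integral do rewrite -section1.
under [RHS]eq_integral do rewrite -section2.
exact: (fubini_tonelli h).
Qed.

End tonelli_relation.

(** * The weighted inequality *)

Section weighted_poincare.
Context {R : realType} {n : nat}.
Notation mu := (@lebesgue_rV R n).
Variables (p s beta : R) (Omega : set 'rV[R]_n).
Hypotheses (n0 : (0 < n)%N) (p1 : 1 < p) (s0 : 0 < s)
  (oO : open Omega) (bO : boundary Omega !=set0).
Local Notation d := (bdist Omega).
Local Notation N := (n%:R : R).

(** The John condition with the single constant [k] in place of [a0 / L], and with unit-speed curves
    relaxed to 1-Lipschitz ones. *)
Definition John_curves (k : R) (x0 : 'rV[R]_n) :=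
  forall x, Omega x -> x <> x0 -> exists L g,
    [/\ 0 <= L, lipschitz1_on L g, g 0 = x, g L = x0 &
      forall t, 0 <= t -> t <= L -> Omega (g t) /\ k * t <= d (g t)].

Lemma powRD_le (a b : R) : 0 <= a -> 0 <= b ->
  (a + b) `^ p <= 2 `^ p * (a `^ p + b `^ p).
Proof.
move=> a0 b0; have p0 : 0 <= p by exact/ltW/lt_trans/p1.
wlog ab : a b a0 b0 / a <= b.
  by move=> H; have [|/ltW ba] := leP a b; [exact: H|rewrite addrC [X in _ * X]addrC H].
apply: (@le_trans _ _ ((2 * b) `^ p)).
  by rewrite ge0_ler_powR ?nnegrE ?addr_ge0 ?mulr_ge0//; lra.
by rewrite powRM// ler_wpM2l ?powR_ge0// lerDr powR_ge0.
Qed.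

Lemma borel_weighted_poincare (k lam C : R) (x0 : 'rV[R]_n) :
  0 < k -> k <= 1 -> Omega x0 -> John_curves k x0 ->
  0 <= lam -> 0 <= C -> covering_bound Omega C lam -> lam < N + beta * p ->
  exists2 A : R, 0 < A & forall (tau : R) (u : 'rV[R]_n -> R),
    0 < tau -> tau < 1 -> measurable_fun setT u ->
    exists c : R, (\int[mu]_(x in Omega) (`|u x - c| `^ p * d x `^ (beta * p))%:E <=
      (A * tau `^ ((s - N) * p))%:E *
      \int[mu]_(x in Omega) energy_density p s beta tau Omega u x)%E.
Proof.
move=> k0 k1 Ox0 John lam0 C0 cov gap.
have p0 : 0 < p by exact: lt_trans p1.
have p10 : 0 < p - 1 by rewrite subr_gt0.
have N1 : 1 <= N by rewrite ler1n.
have N0 : 0 < N by rewrite ltr0n.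
have d0 x : Omega x -> 0 < d x by exact: open_bdist_gt0.
have md : measurable_fun setT d := measurable_bdist bO.
have mO : measurable Omega := open_measurable_rV oO.
(* Half of the available gap, so that [N + al - lam], with [al = beta * p - ep], keeps the other
   half. *)
have [ep epE] : exists r : R, r = (N + beta * p - lam) / 2 by eexists.
have ep0 : 0 < ep by rewrite epE divr_gt0// subr_gt0.
have [e eE] : exists r : R, r * (p - 1) = ep.
  by exists (ep / (p - 1)); rewrite mulfVK// gt_eqF.
have e0 : 0 < e by rewrite -(pmulr_lgt0 _ p10) eE.
have [al alE] : exists r : R, r = beta * p - ep by eexists.
have algap : 0 < N + al - lam by rewrite alE epE; lra.
have [M ME] : exists r : R, r = 2 * (k^-1 + 1) by eexists.
have kV0 : 0 < k^-1 by rewrite invr_gt0.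
have M1 : 1 <= M by rewrite ME; lra.
have [K1 K10 chain] := @John_curve_chain _ _ Omega e k e0 k0 k1 bO.
have [K4 K40 assouad] := integral_distance_powR oO bO lam0 C0 cov algap M1.
have [A1 A1E] : exists r : R, r = 2 `^ `|(beta + s) * p| * (32 * N) `^ N by eexists.
have N32 : 0 < 32 * N by rewrite mulr_gt0.
have A10 : 0 < A1 by rewrite A1E mulr_gt0 ?powR_gt0.
have [A2 A2E] : exists r : R, r = 2 `^ `|ep| * (A1 * (32 * N) `^ N) by eexists.
have A20 : 0 < A2 by rewrite A2E !mulr_gt0 ?powR_gt0.
have [B1 B1E] : exists r : R, r = 2 `^ p * A1 by eexists.
have [B2 B2E] : exists r : R, r = 2 `^ p * (K1 `^ (p - 1) * A2) by eexists.
have B10 : 0 < B1 by rewrite B1E mulr_gt0 ?powR_gt0.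
have B20 : 0 < B2 by rewrite B2E !mulr_gt0 ?powR_gt0.
exists (B1 + B2 * K4); first by rewrite addr_gt0// mulr_gt0.
move=> tau u tau0 tau1 mu_.
have [c cP] := exists_local_means n0 p1 oO bO tau0 mu_.
(* The mean over the cube of the centre, where all chains end. *)
exists (c x0).
set G := energy_density p s beta tau Omega u.
have G0 y : (0 <= G y)%E by exact: energy_density_ge0.
have mG : measurable_fun setT G by exact: measurable_energy_density.
pose V x := visible_set Omega M x.
have mpd e' : measurable_fun setT (fun y => (d y `^ e')%:E).
  by apply/measurable_EFinP; exact: (measurableT_comp (measurable_powR e') md).
pose g y := ((d y `^ (- N - al))%:E * G y)%E.
have mg : measurable_fun setT g by exact: emeasurable_funM.
have g0 y : (0 <= g y)%E by rewrite mule_ge0// lee_fin powR_ge0.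
have gA y : (0 <= (A2 * tau `^ (s * p - N))%:E * g y)%E.
  by apply: mule_ge0 (g0 y); rewrite lee_fin mulr_ge0 ?powR_ge0// ltW.
have mV x : measurable (V x) by exact: measurable_visible_set.
pose Phi x := ((d x `^ al)%:E * \int[mu]_(y in V x) g y)%E.
have Phi0 x : (0 <= Phi x)%E.
  by rewrite mule_ge0 ?lee_fin ?powR_ge0//; exact: integral_ge0.
pose B := [set xy : 'rV[R]_n * 'rV[R]_n | enorm (xy.1 - xy.2) <= M * d xy.2].
have mB : measurable B.
  apply: measurable_set_le.
    exact: (measurable_enormB measurable_fst measurable_snd).
  by apply: measurable_funM => //; exact: (measurableT_comp md measurable_snd).
have d0' x : (0 <= (d x `^ al)%:E)%E by rewrite lee_fin powR_ge0.
have mPhi : measurable_fun Omega Phi :=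
  measurable_relation_integral mu mO mB (mpd al) mg d0' g0.
(* After the exchange, the inner integral of [d x^al] is at most [K4 * d y^(N + al)], which cancels
   the weight in [g]. *)
have intPhi : (\int[mu]_(x in Omega) Phi x <= K4%:E * \int[mu]_(x in Omega) G x)%E.
  have -> : (\int[mu]_(x in Omega) Phi x = _)%E :=
    tonelli_relation mu mO mB (mpd al) mg d0' g0.
  rewrite -ge0_integralZl//; [|exact: measurable_funTS|exact: ltW].
  apply: ge0_le_integral_subset.
  - by move=> y _; rewrite mule_ge0//; apply: integral_ge0 => x _.
  - by move=> y _; rewrite mule_ge0// lee_fin ltW.
  move=> y Oy; split=> //.
  apply: (le_trans (lee_wpmul2l (g0 y) (assouad y Oy))).
  rewrite /g muleAC -EFinM lee_wpmul2r// lee_fin mulrCA -powRD; last first.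
    by rewrite (gt_eqF (d0 _ Oy)) implybT.
  have -> : - N - al + (N + al) = 0 by ring.
  by rewrite powRr0 mulr1.
have pointwise x : Omega x ->
    ((`|u x - c x0| `^ p * d x `^ (beta * p))%:E <=
     (B1 * tau `^ (s * p))%:E * G x + (B2 * tau `^ (1 - p + (s * p - N)))%:E * Phi x)%E.
  move=> Ox; have dx0 := d0 x Ox.
  have own := own_local_mean beta n0 p1 s0 oO bO tau0 tau1 mu_ cP Ox.
  have far : ((`|c x - c x0| `^ p)%:E <=
      (((K1 / tau) * d x `^ (- e)) `^ (p - 1))%:E * \int[mu]_(y in V x)
       ((A2 * tau `^ (s * p - N))%:E * g y))%E.
    (* No curve is given for [x = x0], where the difference of means is zero. *)
    have [->|/eqP xx0] := eqVneq x x0.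
      rewrite subrr normr0 powR0 ?gt_eqF//.
      rewrite mule_ge0 ?lee_fin ?powR_ge0//; exact: integral_ge0.
    have [L [gam [L0 lip gam0 gamL John']]] := John x Ox xx0.
    have [||r [pr lr sep rin rsum]] := chain tau L gam tau0 tau1 L0 lip _ _.
    - by rewrite gam0.
    - by move=> t t0 tL; have [] := John' t t0 tL.
    rewrite gam0 gamL in pr lr sep rin rsum.
    have rO : {in x :: r, forall q, Omega q /\ enorm (q - x) <= k^-1 * d q}.
      move=> q /rin[t /andP[t0 tL] ->]; have [Ot kt] := John' t t0 tL; split => //.
      rewrite -gam0; apply: le_trans (lip 0 t (lexx _) t0 tL) _.
      by rewrite subr0 ler_pdivlMl.
    have := chain_local_means beta n0 p1 s0 oO bO tau0 tau1 mu_ cP e0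
      (ltW kV0) Ox0 pr lr sep rO rsum.
    move=> /le_trans; apply; rewrite lee_wpmul2l ?lee_fin ?powR_ge0//.
    rewrite eE -ME; apply: ge0_le_integral_subset.
    - by move=> y _; rewrite mule_ge0 ?lee_fin ?mulr_ge0 ?powR_ge0//; exact: G0.
    - by move=> y _; exact: gA.
    move=> y Vy; split=> //; rewrite /g muleA -EFinM -/G.
    have -> : ep - N - beta * p = - N - al by rewrite alE; ring.
    rewrite le_eqVlt; apply/orP; left; apply/eqP; congr (_%:E * _)%E.
    by rewrite A2E A1E; ring.
  have h1 : `|u x - c x0| `^ p <= 2 `^ p * (`|u x - c x| `^ p + `|c x - c x0| `^ p).
    apply: le_trans (powRD_le (normr_ge0 _) (normr_ge0 _)).
    by rewrite ge0_ler_powR ?nnegrE ?addr_ge0 ?(ltW p0)// ler_distD.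
  have D0 : 0 <= 2 `^ p * d x `^ (beta * p) by rewrite mulr_ge0 ?powR_ge0.
  apply: (@le_trans _ _ ((2 `^ p * d x `^ (beta * p))%:E *
      ((`|u x - c x| `^ p)%:E + (`|c x - c x0| `^ p)%:E))%E).
    rewrite -EFinD -EFinM lee_fin [leRHS]mulrAC ler_wpM2r ?powR_ge0//.
  apply: (le_trans (lee_wpmul2l _ (leeD own far))); first by rewrite lee_fin.
  rewrite ge0_muleDr; last 2 first.
  - by rewrite mule_ge0// lee_fin !mulr_ge0 ?powR_ge0.
  - rewrite mule_ge0 ?lee_fin ?powR_ge0//; exact: integral_ge0.
  have DD : d x `^ (beta * p) * d x `^ (- (beta * p)) = 1.
    by rewrite powRN mulfV// gt_eqF// powR_gt0.
  rewrite leeD//.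
    rewrite muleA -EFinM -/G le_eqVlt; apply/orP; left; apply/eqP; congr (_%:E * _)%E.
    rewrite B1E A1E; move: DD.
    move: (d x `^ (beta * p)) (d x `^ (- (beta * p))) => D D' DD.
    rewrite -[RHS]mulr1 -DD; ring.
  rewrite ge0_integralZl; last 4 first.
  - exact: mV.
  - exact: measurable_funTS.
  - by move=> y _; exact: g0.
  - by rewrite lee_fin mulr_ge0 ?powR_ge0// ltW.
  rewrite /Phi !muleA -!EFinM le_eqVlt; apply/orP; left; apply/eqP; congr (_%:E * _)%E.
  (* The bound [K1 / tau * d x^-e] on the sum of weights, raised to the power [p - 1], gives
     [tau^(1 - p)] and the factor [d x^(- ep)] that turns [d x^(beta * p)] into [d x^al]. *)
  rewrite powRM ?powR_ge0 ?divr_ge0 ?(ltW K10) ?(ltW tau0)//.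
  rewrite powRM ?invr_ge0 ?(ltW K10) ?(ltW tau0)// -powRrM mulNr eE.
  rewrite -(powR_inv1 (ltW tau0)) -powRrM.
  have -> : -1 * (p - 1) = 1 - p by ring.
  rewrite [tau `^ (1 - p + _)]powRD ?(gt_eqF tau0) ?implybT//.
  rewrite alE (powRD (x := d x)) ?(gt_eqF dx0) ?implybT//.
  by rewrite B2E; ring.
have t1 : tau `^ (s * p) <= tau `^ ((s - N) * p).
  rewrite ger_powR ?tau0 ?(ltW tau1)// mulrBl gerBl mulr_ge0 ?(ltW p0)// ltW//.
have t2 : tau `^ (1 - p + (s * p - N)) <= tau `^ ((s - N) * p).
  rewrite ger_powR ?tau0 ?(ltW tau1)//.
  (* This product is the difference of the two exponents of [tau]. *)
  have : 0 <= (N - 1) * (p - 1) by rewrite mulr_ge0 ?subr_ge0// ltW.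
  by lra.
have b10 : 0 <= B1 * tau `^ (s * p) by rewrite mulr_ge0 ?powR_ge0// ltW.
have b20 : 0 <= B2 * tau `^ (1 - p + (s * p - N)) by rewrite mulr_ge0 ?powR_ge0// ltW.
apply: (@le_trans _ _ (\int[mu]_(x in Omega)
   ((B1 * tau `^ (s * p))%:E * G x + (B2 * tau `^ (1 - p + (s * p - N)))%:E * Phi x))%E).
  apply: ge0_le_integral_subset.
  - by move=> x _; rewrite lee_fin mulr_ge0 ?powR_ge0.
  - by move=> x _; rewrite adde_ge0// mule_ge0// lee_fin.
  - by move=> x Ox; split=> //; exact: pointwise.
have mGO : measurable_fun Omega G by exact: measurable_funTS.
rewrite ge0_integralD; last 5 first.
- exact: mO.
- by move=> x _; apply: mule_ge0.
- exact: measurable_funeM.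
- by move=> x _; apply: mule_ge0.
- exact: measurable_funeM.
rewrite !ge0_integralZl//.
have IG0 : (0 <= \int[mu]_(x in Omega) G x)%E by exact: integral_ge0.
apply: (le_trans (leeD2l _ (lee_wpmul2l _ intPhi))); first by rewrite lee_fin.
rewrite muleA -EFinM -ge0_muleDl ?lee_fin//; last by rewrite mulr_ge0// ltW.
rewrite -EFinD lee_wpmul2r// lee_fin [leRHS]mulrDl lerD//.
  by rewrite ler_wpM2l// ltW.
by rewrite [leLHS]mulrAC ler_wpM2l// mulr_ge0// ltW.
Qed.

End weighted_poincare.

(** * Borel representatives and null sets *)

Section borel_representative.
Context {R : realType} {n : nat}.
Notation mu := (@lebesgue_rV R n).

(** For each rational [q], the set where [u < q] is Borel up to a null set. Outside the union [Z] of
    these countably many null sets, [u] is Borel. *)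
Lemma lebesgue_measurable_fun_borel (D : set 'rV[R]_n) (u : 'rV[R]_n -> R) :
  measurable D -> lebesgue_measurable_fun D u ->
  exists Z (v : 'rV[R]_n -> R), [/\ measurable Z, mu Z = 0%E,
    measurable_fun setT v & forall x, D x -> ~ Z x -> v x = u x].
Proof.
move=> mD mu_.
(* An enumeration of the rationals; naturals that code no rational are sent to 0. *)
pose q k : R := ratr (odflt 0 (unpickle k : option rat)).
have /choice[AZ AZP] : forall k, exists AZ : set 'rV[R]_n * set 'rV[R]_n,
    [/\ measurable AZ.1, measurable AZ.2, mu AZ.2 = 0%E,
      AZ.1 `<=` D `&` [set x | u x < q k] &
      forall x, D x -> u x < q k -> ~ AZ.2 x -> AZ.1 x].
  move=> k; have [A mA [Z [Z' [mZ' Z'0 ZZ']] AZE]] := mu_ _ (measurable_itv `]-oo, q k[).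
  exists (A, Z'); split => //=.
    by move=> x Ax; have : (A `|` Z) x by [left]; rewrite AZE /= in_itv.
  move=> x Dx ux Z'x; have : (A `|` Z) x by rewrite AZE/= in_itv.
  by case=> // /ZZ'.
pose Z := \bigcup_k (AZ k).2.
have mZ : measurable Z by apply: bigcup_measurable => k _; have [] := AZP k.
have Z0 : mu Z = 0%E.
  apply/(negligibleP mu mZ)/negligible_bigcup => k.
  by have [_ mk k0 _ _] := AZP k; exact/negligibleP.
exists Z, (u \_ (D `\` Z)); split => //; last first.
  by move=> x Dx Zx; rewrite patchE ifT//; exact/mem_set.
have mDZ : measurable (D `\` Z) by exact: measurableD.
apply/(measurable_restrictT _ mDZ).
apply: (measurability _ (RGenInftyO.measurableE R)) => _ [_ [a ->] <-].
rewrite (_ : _ `&` _ = \bigcup_k (if q k < a then (AZ k).1 `\` Z else set0)).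
  apply: bigcup_measurable => k _; case: ifP => // _.
  by apply: measurableD => //; have [] := AZP k.
apply/seteqP; split => [x [[Dx Zx]]|x [k _]].
  rewrite /= in_itv/= => /rat_in_itvoo[r]; rewrite in_itv/= => /andP[ur ra].
  have qr : q (pickle r) = ratr r by rewrite /q pickleK.
  exists (pickle r) => //; rewrite qr ra; split => //.
  have [_ _ _ _ AD] := AZP (pickle r); apply: AD => //; first by rewrite qr.
  by move=> Zr; apply: Zx; exists (pickle r).
case: ifP => // qa [Ax Zx]; have [_ _ _ /(_ x Ax)[Dx ux] _] := AZP k.
by split=> //; rewrite /= in_itv/= (lt_trans ux).
Qed.

End borel_representative.

Section null_modification.
Context {R : realType} {n : nat}.
Notation mu := (@lebesgue_rV R n).
Local Open Scope ereal_scope.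

(** The null set is removed in both variables, and [v = u] on what remains. With
    [integral_modification_le], this carries the inequality from the Borel function [v] back to
    [u]. *)
Lemma energy_density_modification_le (p s beta tau : R) (Omega Z : set 'rV[R]_n)
    (u v : 'rV[R]_n -> R) : measurable Z -> mu Z = 0 ->
  (forall x, Omega x -> ~ Z x -> v x = u x) ->
  \int[mu]_(x in Omega) energy_density p s beta tau Omega v x <=
  \int[mu]_(x in Omega) energy_density p s beta tau Omega u x.
Proof.
move=> mZ Z0 vu; apply: le_trans (ge0_le_integral_setD_null mZ Z0 _) _.
  by move=> x _; exact: energy_density_ge0.
apply: ge0_le_integral_subset => [x _|x _|x [Ox Zx]]; try exact: energy_density_ge0.
split=> //; apply: le_trans (ge0_le_integral_setD_null mZ Z0 _) _.
  by move=> y _; rewrite lee_fin energy_kernel_ge0.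
apply: ge0_le_integral_subset => [y _|y _|y [[Oy xy] Zy]].
- by rewrite lee_fin energy_kernel_ge0.
- by rewrite lee_fin energy_kernel_ge0.
- by split=> //; rewrite /energy_kernel !vu.
Qed.

Lemma integral_modification_le (f : R -> 'rV[R]_n -> R) (D Z : set 'rV[R]_n)
    (u v : 'rV[R]_n -> R) : (forall t x, (0 <= f t x)%R) ->
  measurable Z -> mu Z = 0 -> (forall x, D x -> ~ Z x -> v x = u x) ->
  \int[mu]_(x in D) (f (u x) x)%:E <= \int[mu]_(x in D) (f (v x) x)%:E.
Proof.
move=> f0 mZ Z0 vu; apply: le_trans (ge0_le_integral_setD_null mZ Z0 _) _.
  by move=> x _; rewrite lee_fin.
apply: ge0_le_integral_subset => [x _|x _|x [Dx Zx]]; rewrite ?lee_fin//.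
by split=> //; rewrite vu.
Qed.

End null_modification.

(** * Consequences of the John and dimension hypotheses *)

Section John_domain_theory.
Context {R : realType} {n : nat}.

Lemma John_domain_curves (Omega : set 'rV[R]_n) : (0 < n)%N -> John_domain Omega ->
  [/\ open Omega, boundary Omega !=set0 & exists k x0,
    [/\ 0 < k, k <= 1, Omega x0 & John_curves Omega k x0]].
Proof.
move=> n0 [[oO _ _] _ [a0 [b0 [x0 [a00 ab Ox0 J]]]]].
have b00 : 0 < b0 by exact: lt_le_trans ab.
have Lpos x : Omega x -> x <> x0 -> exists L g,
    [/\ 0 < L, L <= b0, arc_length_curve L g, g 0 = x & g L = x0] /\
      forall t, t \in `[0, L] -> Omega (g t) /\ a0 / L * t <= bdist Omega (g t).
  move=> Ox xx0; have [L [g [[L0 Lb gL g0 gLx] H]]] := J x Ox xx0.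
  exists L, g; split => //; split => //; rewrite lt_neqAle L0 andbT eq_sym.
  by apply/eqP => LE; apply: xx0; rewrite -g0 -gLx LE.
split=> //; last first.
  exists (a0 / b0), x0; split => //; first exact: divr_gt0.
    by rewrite ler_pdivrMr// mul1r.
  move=> x Ox xx0; have [L [g [[L0 Lb gL g0 gLx] H]]] := Lpos x Ox xx0.
  exists L, g; split => //; first exact: ltW.
    by move=> a b; exact: arc_length_lip.
  move=> t t0 tL; have [|Ot Ht] := H t; first by rewrite in_itv/= t0.
  split=> //; apply: le_trans Ht; rewrite ler_wpM2r// ler_wpM2l ?(ltW a00)//.
  by rewrite lef_pV2.
(* A point of [Omega] other than [x0], found by moving along one coordinate, provides a John curve
   ending at [x0]. *)
have [e e0 xO] := (open_eballP Omega).1 oO x0 Ox0.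
pose i0 : 'I_n := Ordinal n0.
pose x := x0 + (e / 2) *: delta_mx ord0 i0.
have xx0 : x <> x0.
  move=> xE; have : x - x0 = 0 by rewrite xE subrr.
  rewrite /x addrAC subrr add0r => /rowP/(_ i0).
  rewrite !mxE !eqxx mulr1 => /eqP; rewrite mulf_eq0 invr_eq0 pnatr_eq0 orbF.
  by rewrite gt_eqF.
have Ox : Omega x.
  apply: xO; rewrite /eball/= /x addrAC subrr add0r enormZ.
  have -> : enorm (delta_mx ord0 i0 : 'rV[R]_n) = 1.
    rewrite /enorm (bigD1 i0)//= big1 ?addr0 => [|i ii0].
      by rewrite !mxE !eqxx expr1n sqrtr1.
    by rewrite !mxE (negbTE ii0) andbF expr0n.
  by rewrite mulr1 ger0_norm ?divr_ge0 ?(ltW e0)//; lra.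
have [L [g [[L0 Lb gL g0 gLx] H]]] := Lpos x Ox xx0.
have [|_] := H L; first by rewrite in_itv/= lexx ltW.
rewrite mulfVK ?gt_eqF// gLx => a0d; apply/set0P/eqP => b0'.
by move: a0d; rewrite /bdist b0' /dist_to image_set0 inf0 leNgt a00.
Qed.

Lemma dimA_lt_covering_bound (Omega : set 'rV[R]_n) (b : R) :
  (- (n%:R%:E - dimA (boundary Omega)) < b%:E)%E ->
  exists lam C, [/\ 0 <= lam, 0 <= C, covering_bound Omega C lam & lam < n%:R + b].
Proof.
move=> H; have /ereal_inf_lt[_ [lam [lam0 [C C0 cov]] <-]] :
    (dimA (boundary Omega) < (n%:R + b)%:E)%E.
  (* The value +oo contradicts the hypothesis, and -oo satisfies the claim trivially. *)
  move: H; case: (dimA _) => [r| |]//=; last by move=> _; exact: ltNyr.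
  by rewrite !lte_fin; lra.
rewrite lte_fin => lamb; exists lam, C; split => //; first exact: ltW.
Qed.

End John_domain_theory.

Theorem theorem5p4 (R : realType) (n : nat) (p s beta : R)
    (Omega : set 'rV[R]_n) :
  (2 <= n)%N -> 1 < p -> John_domain Omega -> 0 < s -> s < 1 ->
  (- (n%:R%:E - dimA (boundary Omega)) < (beta * p)%:E)%E ->
  exists C : R, 0 < C /\
    forall (tau : R) (u : 'rV[R]_n -> R), 0 < tau -> tau < 1 ->
      frac_Sobolev Omega s p beta tau u ->
      (ereal_inf [set wLp_norm Omega (dist_weight Omega (beta * p)) p
                        (fun x => u x - c)%R | c in [set: R]]
       <= (C * tau `^ (s - n%:R))%:E *
          frac_energy Omega s p beta tau u `^ p^-1)%E.
Proof.
move=> n2 p1 JO s0 s1 dimO; have n0 : (0 < n)%N by exact: ltnW.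
have p0 : 0 < p by exact: lt_trans p1.
have [oO bO [k [x0 [k0 k1 Ox0 curves]]]] := John_domain_curves n0 JO.
have [lam [C [lam0 C0 cov gap]]] := dimA_lt_covering_bound dimO.
have [A A0 main] := borel_weighted_poincare n0 p1 s0 oO bO k0 k1 Ox0 curves
  lam0 C0 cov gap.
exists (A `^ p^-1); split; first exact: powR_gt0.
move=> tau u tau0 tau1 [mu_ _ _].
(* The inequality is applied to a Borel function [v] equal to [u] outside a null set. *)
have [Z [v [mZ Z0 mv vu]]] := lebesgue_measurable_fun_borel (open_measurable_rV oO) mu_.
have [c cP] := main tau v tau0 tau1 mv.
apply: (@le_trans _ _ (wLp_norm Omega (dist_weight Omega (beta * p)) p
    (fun x => u x - c)%R)); first by apply: ereal_inf_lbound; exists c.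
(* The constant is written as a p-th root, so that only the p-th powers of both sides have to be
   compared. *)
have -> : (A `^ p^-1 * tau `^ (s - n%:R))%:E =
    ((A * tau `^ ((s - n%:R) * p))%:E `^ p^-1)%E.
  rewrite poweR_EFin powRM ?powR_ge0 ?(ltW A0)//.
  by rewrite -powRrM mulfK ?gt_eqF.
have E0 : (0 <= frac_energy Omega s p beta tau u)%E.
  by rewrite frac_energyE; apply: integral_ge0 => x _; exact: energy_density_ge0.
rewrite -poweRM ?lee_fin ?mulr_ge0 ?powR_ge0 ?(ltW A0)//.
rewrite /wLp_norm; apply: gt0_ler_poweR.
- by rewrite invr_ge0 ltW.
- rewrite in_itv/= leey andbT; apply: integral_ge0 => x _.
  by rewrite lee_fin mulr_ge0 ?powR_ge0.
- by rewrite in_itv/= leey andbT mule_ge0// lee_fin mulr_ge0 ?powR_ge0 ?(ltW A0).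
- apply: le_trans (integral_modification_le (f := fun t x =>
    `|t - c| `^ p * dist_weight Omega (beta * p) x) _ mZ Z0 vu) _.
    by move=> t x; rewrite mulr_ge0 ?powR_ge0.
  apply: le_trans cP _; rewrite frac_energyE.
  apply: lee_wpmul2l; first by rewrite lee_fin mulr_ge0 ?powR_ge0 ?(ltW A0).
  exact: energy_density_modification_le mZ Z0 vu.
Qed.
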